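(* Let $\lambda>0$, let $A:[0,+\infty)\to\mathbb{R}$ and $f:[0,1]\times[0,+\infty)\to[0,+\infty)$ be continuous, let $b\in L^1\big((0,1];[0,+\infty)\big)$ be positive almost everywhere with $(b*\mathbf{1})(1)\neq0$, let $0<\rho_1<\rho_2$ be such that $A(t)>0$ for each $t\in[\rho_1,\rho_2]$, let $p:[0,1]\to(0,+\infty)$ be continuous with $p^-\le p(t)\le p^+$ for all $t\in[0,1]$, where $p^-,p^+$ are real constants with $0<p^-<1<p^+<+\infty$, and let $G$ be a Green's function satisfying the assumptions listed in the context, with associated constants $\alpha,\beta,\eta_0,C_0$. Suppose that for some $q>1$ we have $b^{\frac{1}{1-q}}\in L^1\big((0,1]\big)$. Suppose moreover that both of the following inequalities hold: (1) $\displaystyle\eta_0^{p^+}\left[\left(\frac{\lambda f^{m}_{[\alpha,\beta]\times[\eta_0m_{\rho_1},\overline{M}_{\rho_1}]}}{A(\rho_1)}\max_{\tau\in[0,1]}\int_{\alpha}^{\beta}G(\tau,s)\,ds\right)^{p^-}-1\right]\int_{\alpha}^{\beta}b(1-s)\,ds>\rho_1$; (2) $\displaystyle\max\left\{\left(\frac{\lambda f^{M}_{[0,1]\times[0,\overline{M}_{\rho_2}]}G^M}{A(\rho_2)}\right)^{p^+},\left(\frac{\lambda f^{M}_{[0,1]\times[0,\overline{M}_{\rho_2}]}G^M}{A(\rho_2)}\right)^{p^-}\right\}<\frac{\rho_2}{(b*\mathbf{1})(1)}$. Then the problem $$-A\left(\int_0^1b(1-s)\big(u(s)\big)^{p(s)}\,ds\right)u''(t)=\lambda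 f\big(t,u(t)\big),\quad t\in(0,1),$$ subject to the boundary data encoded by the Green's function $G$, has at least one positive solution $u_0\in\widehat{V}_{\rho_2}\setminus\overline{\widehat{V}_{\rho_1}}$, and $u_0$ satisfies $$\left(\frac{\rho_1}{(b*\mathbf{1})(1)}\right)^{\frac{1}{p^+}}+\varepsilon(\rho_1,b)\le\Vert u_0\Vert_{\infty}\le\frac{1}{\eta_0}(\beta-\alpha)^{-\frac{q}{p^-}}\left[\rho_2^{\frac{1}{q}}\left(\left(b^{\frac{1}{1-q}}*\mathbf{1}\right)(1)\right)^{\frac{q-1}{q}}+1\right]^{\frac{q}{p^-}}.$$
   Context: Notation. $\mathscr{C}([0,1])$ is the Banach space of continuous real functions on $[0,1]$ with the maximum norm $\Vert\cdot\Vert_\infty$. $\mathbf{1}$ is the constant function $1$. Finite convolution: $(v*w)(t):=\int_0^tv(t-s)w(s)\,ds$, $0\le t\le1$; in particular $(b*\mathbf{1})(1)=\int_0^1b(1-s)\,ds$ and $(b*u^{p(\cdot)})(1):=\int_0^1b(1-s)(u(s))^{p(s)}\,ds$. For continuous $h:[0,1]\times[0,+\infty)\to[0,+\infty)$, $h^m_{[a,b]\times[c,d]}$ and $h^M_{[a,b]\times[c,d]}$ denote respectively the minimum and the maximum of $h$ over $[a,b]\times[c,d]$. Assumptions on $G$: $G:[0,1]\times[0,1]\to[0,+\infty)$ is continuous and is the Green's function of $-u''$ under given (homogeneous) boundary data (e.g. Dirichlet). Put $\mathscr{G}(s):=\max_{t\in[0,1]}G(t,s)$. There are numbers $0\le\alpha<\beta\le1$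 and $\eta_0=\eta_0(\alpha,\beta)\in(0,1]$ with $\min_{t\in[\alpha,\beta]}G(t,s)\ge\eta_0\mathscr{G}(s)$ for each $s\in[0,1]$. Moreover $C_0:=\inf_{s\in(0,1)}\frac{1}{\mathscr{G}(s)}\int_0^1G(t,s)\,dt$ satisfies $C_0>0$ (implicitly $\mathscr{G}(s)>0$ for $s\in(0,1)$). Cone and sets: $$\mathscr{K}:=\Big\{u\in\mathscr{C}([0,1]):u\ge0,\ \min_{t\in[\alpha,\beta]}u(t)\ge\eta_0\Vert u\Vert_\infty,\ (\mathbf{1}*u)(1)\ge C_0\Vert u\Vert_\infty\Big\},$$ and for $\rho>0$, $\widehat{V}_\rho:=\{u\in\mathscr{K}:(b*u^{p(\cdot)})(1)<\rho\}$, a relatively open subset of $\mathscr{K}$; closures are relative to $\mathscr{K}$. A positive solution of the problem subject to the boundary data encoded by $G$ means a nontrivial $u\in\mathscr{K}$, with $A\big((b*u^{p(\cdot)})(1)\big)>0$, that is a fixed point $u=Tu$ of $$(Tu)(t):=\lambda\int_0^1\Big(A\big((b*u^{p(\cdot)})(1)\big)\Big)^{-1}G(t,s)f(s,u(s))\,ds;$$ such a fixed point satisfies the differential equation and the boundary conditions because $G$ is the Green's function. Constants, for $\rho>0$: $$G^M:=\max_{\tau\in[0,1]}\int_0^1G(\tau,s)\,ds,\qquad m_\rho:=\left(\frac{\rho}{(b*\mathbf{1})(1)}\right)^{\frac1{p^+}}+\varepsilon(\rho,b),$$ $$\overline{M}_\rho:=\frac1{\eta_0}(\beta-\alpha)^{-\frac{q}{p^-}}\left[\rho^{\frac1q}\left(\left(b^{\frac1{1-q}}*\mathbf{1}\right)(1)\right)^{\frac{q-1}{q}}+1\right]^{\frac{q}{p^-}},$$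 where $$\varepsilon(\rho,b):=\begin{cases}\left(\frac{\rho}{(b*\mathbf{1})(1)}\right)^{\frac1{p^-}}-\left(\frac{\rho}{(b*\mathbf{1})(1)}\right)^{\frac1{p^+}},&0<\left(\frac{\rho}{(b*\mathbf{1})(1)}\right)^{\frac1{p^+}}<1,\\0,&\left(\frac{\rho}{(b*\mathbf{1})(1)}\right)^{\frac1{p^+}}\ge1.\end{cases}$$ *)

(* Defs.v *)
From HB Require Import structures.
From mathcomp Require Import all_boot all_order all_algebra.
From mathcomp Require Import all_classical all_reals all_analysis.
From mathcomp Require Import ring.

Set Implicit Arguments.
Unset Strict Implicit.
Unset Printing Implicit Defensive.

Import Order.TTheory GRing.Theory Num.Theory.
Import numFieldNormedType.Exports.

Local Open Scope classical_set_scope.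
Local Open Scope ring_scope.

(* An element of C([0,1]) is represented by a function [u : R -> R] such that
   [{within `[0, 1], continuous u}]; all the notions below depend only on the
   values of [u] on [0,1]. *)

(* These are used for continuous [h] on nonempty compact [D] only, where the
   supremum and the infimum are attained. *)
Definition max_on (R : realType) (T : Type) (D : set T) (h : T -> R) : R :=
  sup [set h x | x in D].

Definition min_on (R : realType) (T : Type) (D : set T) (h : T -> R) : R :=
  inf [set h x | x in D].

Definition rect_max (R : realType) (h : R -> R -> R) (a b c d : R) : R :=
  max_on (`[a, b] `*` `[c, d]) (uncurry h).

Definition rect_min (R : realType) (h : R -> R -> R) (a b c d : R) : R :=
  min_on (`[a, b] `*` `[c, d]) (uncurry h).

Definition max_norm (R : realType) (u : R -> R) : R :=
  max_on `[0, 1] (fun t => `|u t|).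

Definition fconv (R : realType) (v w : R -> R) (t : R) : R :=
  \int[lebesgue_measure]_(s in `[0, t]) (v (t - s) * w s).

Definition nonlocal (R : realType) (b p u : R -> R) : R :=
  fconv b (fun s => u s `^ p s) 1.

Definition is_neg_derive2 (R : realType) (w g : R -> R) : Prop :=
  {within `[0, 1], continuous w} /\
  forall t, t \in `]0, 1[ ->
    [/\ derivable w t 1, derivable (derive1 w) t 1 &
        - derive1 (derive1 w) t = g t].

(* Homogeneous boundary data, given as the set [bc] of the functions on [0,1]
   that satisfy them (for Dirichlet data, [set w | w 0 = 0 /\ w 1 = 0]). *)
Definition homogeneous_bc (R : realType) (bc : set (R -> R)) : Prop :=
  [/\ bc (fun=> 0),
      forall (a : R) (v w : R -> R),
        bc v -> bc w -> bc (fun t => a * v t + w t) &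
      forall v w : R -> R, {in `[0, 1], v =1 w} -> bc v -> bc w].

(* Since [-w'' = g] with [g] continuous on [0,1], [w] is automatically C^2 up
   to the endpoints. The left-to-right implication is the uniqueness of the
   solution of the boundary value problem. *)
Definition green_function (R : realType) (bc : set (R -> R))
    (G : R -> R -> R) : Prop :=
  forall g : R -> R, {within `[0, 1], continuous g} ->
  forall w : R -> R,
    (is_neg_derive2 w g /\ bc w) <->
    {in `[0, 1], forall t,
      w t = \int[lebesgue_measure]_(s in `[0, 1]) (G t s * g s)}.

Definition green_sup (R : realType) (G : R -> R -> R) (s : R) : R :=
  max_on `[0, 1] (fun t => G t s).

Definition C0 (R : realType) (G : R -> R -> R) : R :=
  inf [set (green_sup G s)^-1 *
           \int[lebesgue_measure]_(t in `[0, 1]) G t s | s in `]0, 1[].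

Definition cone (R : realType) (G : R -> R -> R) (alpha beta eta0 : R) :
    set (R -> R) :=
  [set u : R -> R | [/\ {within `[0, 1], continuous u},
               {in `[0, 1], forall t, 0 <= u t},
               min_on `[alpha, beta] u >= eta0 * max_norm u &
               fconv (fun=> 1) u 1 >= C0 G * max_norm u]].

Definition Vhat (R : realType) (G : R -> R -> R) (alpha beta eta0 : R)
    (b p : R -> R) (rho : R) : set (R -> R) :=
  [set u : R -> R | cone G alpha beta eta0 u /\ nonlocal b p u < rho].

(* [{uniform` `[0, 1] -> R}] is [R -> R] with the topology of uniform
   convergence on [0,1], that is, the topology of [max_norm]. *)
Definition Vhat_closure (R : realType) (G : R -> R -> R)
    (alpha beta eta0 : R) (b p : R -> R) (rho : R) : set (R -> R) :=
  cone G alpha beta eta0 `&`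
  closure (Vhat G alpha beta eta0 b p rho : set {uniform` `[0, 1] -> R}).

Definition hammerstein (R : realType) (lambda : R) (A : R -> R)
    (f G : R -> R -> R) (b p u : R -> R) (t : R) : R :=
  lambda * \int[lebesgue_measure]_(s in `[0, 1])
    ((A (nonlocal b p u))^-1 * G t s * f s (u s)).

Definition positive_solution (R : realType) (lambda : R) (A : R -> R)
    (f G : R -> R -> R) (b p : R -> R) (alpha beta eta0 : R) (u : R -> R) :
    Prop :=
  [/\ cone G alpha beta eta0 u,
      exists2 t, t \in `[0, 1] & u t != 0,
      A (nonlocal b p u) > 0 &
      {in `[0, 1], forall t, u t = hammerstein lambda A f G b p u t}].

Definition greenM (R : realType) (G : R -> R -> R) : R :=
  max_on `[0, 1]
    (fun tau => \int[lebesgue_measure]_(s in `[0, 1]) G tau s).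

(* [pm] and [pp] stand for p^- and p^+. *)
Definition eps (R : realType) (b : R -> R) (pm pp rho : R) : R :=
  let r := rho / fconv b (fun=> 1) 1 in
  if 0 < r `^ pp^-1 < 1 then r `^ pm^-1 - r `^ pp^-1 else 0.

Definition mlow (R : realType) (b : R -> R) (pm pp rho : R) : R :=
  (rho / fconv b (fun=> 1) 1) `^ pp^-1 + eps b pm pp rho.

Definition Mbar (R : realType) (b : R -> R) (alpha beta eta0 pm q rho : R) :
    R :=
  eta0^-1 * (beta - alpha) `^ (- (q / pm)) *
  (rho `^ q^-1 *
     fconv (fun s => b s `^ (1 - q)^-1) (fun=> 1) 1 `^ ((q - 1) / q)
   + 1) `^ (q / pm).

Lemma within_continuous_pair (R : realType) (h : R -> R -> R) (D : set (R * R))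
    (v w : R -> R) :
  {within D, continuous (uncurry h)} ->
  {within `[0, 1], continuous v} -> {within `[0, 1], continuous w} ->
  {in `[0, 1], forall s, D (v s, w s)} ->
  {within `[0, 1], continuous (fun s => h (v s) (w s))}.
Proof.
move=> /subspace_continuousP hc /subspace_continuousP vc.
move=> /subspace_continuousP wc vwD.
apply/subspace_continuousP => s s01 P hP.
have := hc _ (vwD _ s01) _ hP; rewrite /= {1}/within/=.
move=> -[[B1 B2] /= [/(vc _ s01) B1s /(wc _ s01) B2s] BP].
have {}B1s : \forall x \near s, `[0, 1]%classic x -> B1 (v x) := B1s.
have {}B2s : \forall x \near s, `[0, 1]%classic x -> B2 (w x) := B2s.
rewrite nbhs_simpl /within/=; apply: filterS2 B1s B2s => x vx wx x01.
by apply: (BP (v x, w x)); [split; [exact: vx|exact: wx]|exact: vwD].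
Qed.

(* A positive solution satisfies the differential equation and the boundary
   conditions. *)
Lemma positive_solution_bvp (R : realType) (lambda : R) (A : R -> R)
    (f G : R -> R -> R) (b p : R -> R) (alpha beta eta0 : R)
    (bc : set (R -> R)) (u : R -> R) :
  {within `[0, 1] `*` `[0, 1], continuous (uncurry G)} ->
  {within `[0, 1] `*` `[0, +oo[, continuous (uncurry f)} ->
  green_function bc G ->
  positive_solution lambda A f G b p alpha beta eta0 u ->
  bc u /\
  {in `]0, 1[, forall t,
    - (A (nonlocal b p u) * derive1 (derive1 u) t) = lambda * f t (u t)}.
Proof.
move=> Gc fc green [[uc u0 _ _] _ Apos ufix].
set a := A _ in Apos *.
have idc : {within `[0, 1], continuous (@id R)}.
  by apply: continuous_subspaceT => x; exact: cvg_id.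
have fuc : {within `[0, 1], continuous (fun s => f s (u s))}.
  apply: within_continuous_pair fc idc uc _ => s s01; split => //=.
  by rewrite in_itv/= andbT u0.
pose g s := lambda / a * f s (u s).
have gc : {within `[0, 1], continuous g}.
  by move=> x; apply: cvgM; [exact: cvg_cst|exact: fuc].
have [_ /(_ _)] := green g gc u.
case=> [t t01|[_ ueq] bcu].
  rewrite ufix// /hammerstein -/a -RintegralZl//.
    by apply: eq_Rintegral => s _; rewrite /g; ring.
  apply: continuous_compact_integrable; first exact: segment_compact.
  move=> x; apply: cvgM; last exact: fuc.
  apply: cvgM; first exact: cvg_cst.
  apply: (within_continuous_pair Gc _ idc).
    by apply: continuous_subspaceT => y; exact: cvg_cst.
  by move=> s s01; split.
split=> // t t01; have [_ _ e] := ueq t t01.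
by rewrite -mulrN e /g mulrA mulrCA divff ?gt_eqF// mulr1.
Qed.

(* Main.v *)
Require Import Defs.
From HB Require Import structures.
From mathcomp Require Import all_boot all_order all_algebra.
From mathcomp Require Import zify.

Set Implicit Arguments.
Unset Strict Implicit.
Unset Printing Implicit Defensive.

(** The operator T is defined and well behaved only where A is positive, that
    is, where the nonlocal quantity phi(u), the value at 1 of the convolution
    of b with u^p, lies in [rho1, rho2].  The proof replaces T by an operator
    [trunc_op] that is defined everywhere and whose fixed points are fixed
    points of T.  Two truncations are made.  The argument of A is clipped to
    [rho1, rho2].  In f(s, u(s)), the value u(s) is cut from above at
    [Mbar rho2], and, for s in [alpha, beta], raised to at least
    eta0 * [mlow rho1].

    The truncated operator is continuous for the uniform distance, and its
    values lie in the cone, are uniformly bounded and are equicontinuous; so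
    it has a fixed point u in the cone ([schauder], [trunc_op_fixpoint]).
    Three cases remain.

    - If phi(u) >= rho2, the coefficient is lambda / A(rho2), f is bounded by
      its maximum over the rectangle of condition (2), and integrating against
      G gives a bound on u for which condition (2) says phi(u) < rho2
      ([trunc_op_fixpoint_lt]).
    - If phi(u) <= rho1, the coefficient is lambda / A(rho1) and u is at most
      [Mbar rho1]; the cut argument of f then lies in the rectangle of
      condition (1), which gives a lower bound for the maximum of u, hence by
      the cone condition for u on [alpha, beta], for which condition (1) says
      phi(u) > rho1 ([trunc_op_fixpoint_gt]).
    - If rho1 < phi(u) < rho2, both truncations are inactive and u = Tu.

    The a priori bounds that make the truncations inactive hold for every u
    in the cone: phi(u) >= rho forces the norm of u to be at least [mlow rho]
    by monotonicity ([mlow_le_norm]), and phi(u) <= rho forces it to be at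
    most [Mbar rho] by a reverse Hoelder inequality ([norm_le_Mbar]).

    The fixed point theorem is built from the ground up.  A parity argument
    on a family of linear orders (Scarf) yields a combinatorial lemma on the
    lattice points of a simplex; refining the lattice gives Brouwer's theorem;
    interpolation at finitely many nodes and a cluster point in a product of
    segments (Tychonoff) give the infinite dimensional statement. *)

(** * Parity of rainbow facets *)
Section Parity.
Variables (X I : finType) (c : X -> I).

(** The parity step of Sperner's lemma.  A set s with as many points as there
    are colours has exactly one facet coloured by all colours but i0 when s
    is rainbow: remove its point of colour i0.  Otherwise, if it has one such
    facet s \ x, then the colour of x occurs exactly once more, at some y, and
    the facets of this kind are s \ x and s \ y. *)
Lemma odd_rainbow_facets (i0 : I) (s : {set X}) : #|s| = #|I| ->
  odd #|[set x in s | c @: (s :\ x) == ~: [set i0]]| = (c @: s == setT).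
Proof.
move=> sI; case: eqP => [cs|cs].
  have cinj : {in s &, injective c}.
    by apply/imset_injP; rewrite cs cardsT sI.
  have /imsetP[x xs ix] : i0 \in c @: s by rewrite cs.
  suff -> : [set x in s | c @: (s :\ x) == ~: [set i0]] = [set x].
    by rewrite cards1.
  apply/setP => y; rewrite !inE; apply/andP/eqP => [[ys /eqP e]|->].
    apply/eqP/negPn/negP => yx.
    have : i0 \in c @: (s :\ y) by rewrite ix imset_f// !inE eq_sym yx.
    by rewrite e !inE eqxx.
  split=> //; apply/eqP/setP => i; rewrite !inE; apply/imsetP/idP.
    move=> [z /setD1P[zx zs] ->]; apply: contra zx => /eqP.
    by rewrite ix => /cinj ->.
  move=> ii; have /imsetP[z zs iz] : i \in c @: s by rewrite cs.
  by exists z => //; rewrite !inE zs andbT; apply: contra ii => /eqP zx; rewrite iz ix zx.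
have [->|] := eqVneq [set x in s | c @: (s :\ x) == ~: [set i0]] set0.
  by rewrite cards0.
case/set0Pn => x; rewrite inE => /andP[xs /eqP ex].
have cinj : {in s :\ x &, injective c}.
  apply/imset_injP; rewrite ex; apply/eqP.
  by have := cardsD1 x s; rewrite xs sI cardsC1 => ->.
have cx : c x \in c @: (s :\ x).
  rewrite ex !inE; apply/eqP => cxi; apply: cs; apply/setP => i; rewrite inE.
  have [->|ii] := eqVneq i i0; first by rewrite -cxi imset_f.
  have : i \in c @: (s :\ x) by rewrite ex !inE.
  by apply: subsetP; apply: imsetS; exact: subD1set.
have /imsetP[y ysx cxy] := cx.
have yx : x != y by move: ysx; rewrite !inE eq_sym => /andP[].
have ys : y \in s by move: ysx; rewrite !inE => /andP[].
suff -> : [set x in s | c @: (s :\ x) == ~: [set i0]] = [set x; y].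
  by rewrite cards2 yx.
apply/setP => z; rewrite !inE; apply/andP/orP => [[zs /eqP ez]|].
  have [->|zx] := eqVneq z x; [by left|right].
  apply/negPn/negP => zy.
  have : c z \in c @: (s :\ z).
    by rewrite ez -ex imset_f// !inE zx.
  case/imsetP => z' /setD1P[z'z z's] cz.
  have [z'x|z'x] := eqVneq z' x.
    move: cz; rewrite z'x cxy => /cinj; rewrite !inE zx zs eq_sym yx ys.
    by move=> /(_ isT isT) /eqP; rewrite (negPf zy).
  move: cz => /cinj; rewrite !inE zx zs z'x z's => /(_ isT isT) /eqP.
  by rewrite eq_sym (negPf z'z).
case=> /eqP->; split => //; first by rewrite ex.
apply/eqP; rewrite -ex; apply/setP => i; apply/imsetP/imsetP => -[w].
  move=> /setD1P[wy ws] ->; have [->|wx] := eqVneq w x.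
    by exists y.
  by exists w => //; rewrite !inE wx.
move=> /setD1P[wx ws] ->; have [->|wy] := eqVneq w y.
  by exists x => //; rewrite !inE yx.
by exists w => //; rewrite !inE wy.
Qed.

(** Double counting of the pairs (cell, facet coloured by all colours but i0)
    that are incident, modulo 2. *)
Lemma odd_rainbow (i0 : I) (Q : pred {set X}) :
  (forall s, Q s -> #|s| = #|I|) ->
  odd #|[set s | Q s && (c @: s == setT)]| =
  odd (\sum_(t : {set X} | c @: t == ~: [set i0])
         #|[set x | (x \notin t) && Q (x |: t)]|).
Proof.
move=> Qc.
have -> : \sum_(t : {set X} | c @: t == ~: [set i0])
            #|[set x | (x \notin t) && Q (x |: t)]| =
          \sum_(s | Q s) #|[set x in s | c @: (s :\ x) == ~: [set i0]]|.
  under [RHS]eq_bigr do rewrite -sum1dep_card.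
  under [LHS]eq_bigr do rewrite -sum1dep_card.
  rewrite !pair_big_dep/=.
  rewrite (reindex_onto (fun sx : {set X} * X => (sx.1 :\ sx.2, sx.2))
             (fun tx => (tx.2 |: tx.1, tx.2)))/=.
    apply: eq_bigl => -[s x]; rewrite /= !inE.
    rewrite eqxx xpair_eqE eqxx andbT /=.
    have [xs|xs] := boolP (x \in s).
      by rewrite setD1K// eqxx andbT /= andbC.
    rewrite /= !andbF; apply/negP => /andP[_ /eqP e].
    by move: xs; rewrite -e setU11.
  by move=> [t x] /= => /andP[_ /andP[xt _]]; rewrite setU1K.
rewrite -sum1dep_card big_mkcondr/=.
elim/big_rec2: _ => //= s m n Qs; rewrite !oddD => ->.
by rewrite odd_rainbow_facets ?Qc//; case: ifP.
Qed.

End Parity.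

(** * Scarf's lemma *)

(** The points are those of T together with one slack point [inr i] per index
    i, placed first for the order of rank i and after T for the other orders.
    Geometrically, T is a set of points of a simplex ordered by their
    coordinates, and the slack points are points at infinity: they
    make the dominant sets of cardinal #|I| behave as the cells of a
    triangulation. *)
Section Scarf.
Variables (T I : finType) (r : I -> T + I -> nat).
Hypothesis r_inj : forall i, injective (r i).
Hypothesis slack_min : forall i z, r i (inr i) < r i (inl z).
Hypothesis slack_top : forall i j z, i != j -> r i (inl z) < r i (inr j).

Definition dominant (s : {set T + I}) :=
  [forall y, [exists i, [forall x in s, r i y <= r i x]]].

Lemma dominantP (s : {set T + I}) :
  reflect (forall y, exists i, forall x, x \in s -> r i y <= r i x)
          (dominant s).
Proof.
apply: (iffP forallP) => H y; first have /existsP[i /forall_inP Hi] := H y.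
  by exists i.
by apply/existsP; have [i Hi] := H y; exists i; apply/forall_inP.
Qed.

(** For a dominant t with one point less than a cell, let m i be the smallest
    point of t for the order i.  Dominance makes m surjective onto t, so m
    identifies exactly one pair of indices a <> b.  A point x completes t to a
    cell precisely when, for k = a or k = b, x is the largest point for the
    order k among the points that exceed m i for every i <> k.  Hence an inner
    facet belongs to exactly two cells. *)
Section InnerFacet.
Variables (t : {set T + I}) (z0 : T).
Hypothesis z0t : inl z0 \in t.
Hypothesis tI : #|t|.+1 = #|I|.
Hypothesis dom_t : dominant t.

Let m i := [arg min_(x < inl z0 in t) r i x].

Let mt i : m i \in t.
Proof. by rewrite /m; case: arg_minnP. Qed.

Let m_min i x : x \in t -> r i (m i) <= r i x.
Proof. by rewrite /m; case: arg_minnP => // y _ + xt; apply. Qed.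

Let m_onto x : x \in t -> exists i, m i = x.
Proof.
move=> xt; have /dominantP/(_ x)[i Hi] := dom_t; exists i.
by apply/(@r_inj i)/eqP; rewrite eqn_leq m_min//= Hi.
Qed.

Let M k := [set y | [forall i, (i != k) ==> (r i (m i) < r i y)]].

Let MP k y : reflect (forall i, i != k -> r i (m i) < r i y) (y \in M k).
Proof. by rewrite inE; apply: forall_inP. Qed.

Let slackM k : inr k \in M k.
Proof.
apply/MP => i ik; apply: leq_ltn_trans (slack_top z0 ik); exact: m_min.
Qed.

Let top k := [arg max_(x > inr k in M k) r k x].

Let topM k : top k \in M k.
Proof. by rewrite /top; case: arg_maxnP. Qed.

Let top_max k y : y \in M k -> r k y <= r k (top k).
Proof. by rewrite /top; case: arg_maxnP => // x _ + yM; apply. Qed.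

Let dominant_top k : dominant (top k |: t).
Proof.
apply/dominantP => y.
have [/existsP[i /andP[ik yi]]|] := boolP [exists i, (i != k) && (r i y <= r i (m i))].
  exists i => x; rewrite !inE => /orP[/eqP->|xt].
    by apply: ltnW (leq_ltn_trans yi _); apply: (MP _ _ (topM k)).
  exact: leq_trans yi (m_min i xt).
rewrite negb_exists => /forallP H.
have yM : y \in M k.
  by apply/MP => i ik; have := H i; rewrite ik/= -ltnNge.
have /dominantP/(_ y)[i Hi] := dom_t.
have ik : i = k.
  apply/eqP/negPn/negP => ik; have := MP _ _ yM _ ik.
  by rewrite ltnNge Hi.
exists k => x; rewrite !inE => /orP[/eqP->|xt]; first exact: top_max.
by rewrite -ik; exact: Hi.
Qed.

Let m_double : exists a b, [/\ a != b, m a = m b &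
  forall k, {in ~: [set k] &, injective m} -> k \in [set a; b]].
Proof.
have mimg : m @: setT = t.
  apply/setP => x; apply/imsetP/idP => [[i _ ->//]|/m_onto[i <-]].
  by exists i.
have : ~~ [forall a, [forall b, (a != b) ==> (m a != m b)]].
  apply/negP => /forallP H.
  have minj : {in [set: I] &, injective m}.
    move=> a b _ _ /eqP mab; apply/eqP/negPn/negP => ab.
    by have /forall_inP/(_ b ab) := H a; rewrite mab.
  have := card_in_imset minj; rewrite mimg cardsT -tI => /eqP.
  by rewrite ltn_eqF.
rewrite negb_forall => /existsP[a]; rewrite negb_forall => /existsP[b].
rewrite negb_imply => /andP[ab /negPn/eqP mab]; exists a, b; split => // k kinj.
rewrite !inE; apply/negPn/negP; rewrite negb_or ![k == _]eq_sym => /andP[ka kb].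
by have := kinj a b; rewrite !inE ka kb => /(_ isT isT mab)/eqP; rewrite (negPf ab).
Qed.

Lemma inner_facet_even : ~~ odd #|[set x | (x \notin t) && dominant (x |: t)]|.
Proof.
have [a [b [ab mab abP]]] := m_double.
have topnt k k' : k' != k -> m k = m k' -> top k \notin t.
  move=> kk' mkk'; apply/negP => /m_onto[i im].
  have [ik|ik] := eqVneq i k.
    by have := MP _ _ (topM k) _ kk'; rewrite -im ik mkk' ltnn.
  by have := MP _ _ (topM k) _ ik; rewrite im ltnn.
have topab : top a != top b.
  apply/eqP => e; have /dominantP/(_ (top a))[i Hi] := dom_t.
  have [ia|ia] := eqVneq i a.
    have ib : i != b by rewrite ia.
    by have := MP _ _ (topM b) _ ib; rewrite -e ltnNge Hi.
  by have := MP _ _ (topM a) _ ia; rewrite ltnNge Hi.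
suff -> : [set x | (x \notin t) && dominant (x |: t)] = [set top a; top b].
  by rewrite cards2 topab.
apply/setP => x; rewrite !inE; apply/andP/orP => [[xt dx]|]; last first.
  case=> /eqP ->; split => //.
    by apply: topnt mab; rewrite eq_sym.
  exact: topnt (esym mab).
pose m' i := [arg min_(z < x in x |: t) r i z].
have m't i : m' i \in x |: t.
  by rewrite /m'; case: arg_minnP => //; rewrite setU11.
have m'_min i z : z \in x |: t -> r i (m' i) <= r i z.
  rewrite /m'; case: arg_minnP => //; first by rewrite setU11.
  by move=> y _ + xt'; apply.
have m'img : m' @: setT = x |: t.
  apply/setP => z; apply/imsetP/idP => [[i _ ->//]|zt].
  have /dominantP/(_ z)[i Hi] := dx; exists i => //.
  by apply/(@r_inj i)/eqP; rewrite eqn_leq Hi//= m'_min.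
have m'inj : {in setT &, injective m'}.
  by apply/imset_injP; rewrite m'img cardsU1 xt cardsT -tI.
have /dominantP/(_ x)[k Hk] := dx.
have m'k : m' k = x.
  apply/(@r_inj k)/eqP; rewrite eqn_leq Hk//= m'_min// setU11//.
have m'm i : i != k -> m' i = m i.
  move=> ik; have : m' i \in t.
    have := m't i; rewrite !inE => /orP[/eqP|//]; rewrite -m'k => /m'inj.
    by rewrite !inE => /(_ isT isT)/eqP; rewrite (negPf ik).
  move=> m'it; apply/(@r_inj i)/eqP; rewrite eqn_leq m_min// m'_min//.
  by rewrite inE mt orbT.
have xM : x \in M k.
  apply/MP => i ik; rewrite ltn_neqAle -m'm// m'_min ?setU11// andbT.
  apply/eqP => /r_inj; rewrite -m'k => /m'inj.
  by rewrite !inE => /(_ isT isT)/eqP; rewrite (negPf ik).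
have xtop : x = top k.
  apply/(@r_inj k)/eqP; rewrite eqn_leq top_max//=.
  have /dominantP/(_ (top k))[i Hi] := dx.
  have [ik|ik] := eqVneq i k; first by rewrite ik in Hi; rewrite Hi// setU11.
  by have := MP _ _ (topM k) _ ik; rewrite ltnNge Hi// inE mt orbT.
have : k \in [set a; b].
  apply: abP => i j; rewrite !inE => ik jk; rewrite -!m'm// => /m'inj.
  by rewrite !inE; apply.
by rewrite !inE => /orP[]/eqP kE; rewrite xtop kE eqxx; [left|right].
Qed.

End InnerFacet.

(** A facet made of slack points only is completed by a single point, the last
    one of T for the missing order: this is the boundary door from which the
    parity argument starts. *)
Lemma outer_facet_odd (z0 : T) i0 :
  #|[set x | (x \notin [set inr j | j in ~: [set i0]]) &&
             dominant (x |: [set inr j | j in ~: [set i0]])]| = 1.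
Proof.
set t := [set inr j | j in ~: [set i0]].
have slackt j : (inr j \in t) = (j != i0).
  by rewrite mem_imset; [rewrite !inE|move=> ? ? []].
have inlt z : (inl z \in t) = false.
  by apply/negbTE/negP => /imsetP[].
pose top := [arg max_(z > z0) r i0 (inl z)].
have topP z : r i0 (inl z) <= r i0 (inl top).
  by rewrite /top; case: arg_maxnP => // y _; apply.
suff -> : [set x | (x \notin t) && dominant (x |: t)] = [set inl top].
  by rewrite cards1.
apply/setP => x; rewrite !inE; apply/andP/eqP => [[xt /dominantP dx]|->].
  case: x xt dx => [z|j]; rewrite ?inlt ?slackt => xt dx.
    congr inl; apply/(@inl_inj T I)/(@r_inj i0)/eqP; rewrite eqn_leq topP/=.
    have [i Hi] := dx (inl top).
    have [ii0|ii0] := eqVneq i i0; first by rewrite ii0 in Hi; rewrite Hi// setU11.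
    have := Hi (inr i); rewrite !inE slackt ii0 orbT => /(_ isT).
    by rewrite leqNgt slack_min.
  move: xt => /negPn/eqP jE; have [i Hi] := dx (inl z0).
  have := Hi (inr i); rewrite !inE slackt jE.
  have [->|ii0] := eqVneq i i0; rewrite ?eqxx ?orbT => /(_ isT).
    by rewrite leqNgt slack_min.
  by rewrite leqNgt slack_min.
split; first by rewrite inlt.
apply/dominantP => -[z|j].
  exists i0 => w; rewrite !inE => /orP[/eqP->//|/imsetP[j ji ->]].
  by apply/ltnW/slack_top; rewrite eq_sym; move: ji; rewrite !inE.
exists j => w; rewrite !inE => /orP[/eqP->|/imsetP[j' ji ->]].
  exact/ltnW/slack_min.
have [->//|jj'] := eqVneq j j'.
exact: ltnW (ltn_trans (slack_min j z0) (slack_top z0 jj')).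
Qed.

(** Among the facets coloured by all colours but i0, the only one without a
    point of T is the set of slack points other than i0.  It lies in one cell
    and all the others lie in two cells, so the number of rainbow cells is
    odd. *)
Lemma scarf (z0 : T) (i0 : I) (c : T + I -> I) : (forall i, c (inr i) = i) ->
  exists s : {set T + I}, [/\ #|s| = #|I|, dominant s & c @: s = setT].
Proof.
move=> cslack; pose Q (s : {set T + I}) := (#|s| == #|I|) && dominant s.
have Qc s : Q s -> #|s| = #|I| by case/andP => /eqP.
suff : odd #|[set s | Q s && (c @: s == setT)]|.
  have [->|/set0Pn[s]] := eqVneq [set s | Q s && (c @: s == setT)] set0.
    by rewrite cards0.
  by rewrite inE => /andP[/andP[/eqP ? ?] /eqP ?] _; exists s.
rewrite (odd_rainbow c i0 Qc).
pose t := [set inr j | j in ~: [set i0]] : {set T + I}.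
have ct : c @: t == ~: [set i0].
  apply/eqP/setP => i; apply/imsetP/idP => [[_ /imsetP[j ji ->] ->]|ii0].
    by rewrite cslack.
  by exists (inr i); rewrite ?cslack// imset_f.
have cardt : #|t|.+1 = #|I|.
  rewrite card_imset; last by move=> ? ? [].
  by rewrite cardsC1 prednK//; apply/card_gt0P; exists i0.
rewrite (bigD1 t)//= oddD.
have -> : #|[set x | (x \notin t) & Q (x |: t)]| = 1.
  rewrite -(outer_facet_odd z0 i0) -/t; apply: eq_card => x; rewrite !inE.
  have [//|xt] := boolP (x \in t).
  by rewrite /Q cardsU1 xt add1n cardt eqxx.
rewrite /= (_ : odd _ = false)//.
apply: (big_ind (fun n => odd n = false)) => // [m n|t' /andP[/eqP ct' tt']].
  by rewrite oddD => -> ->.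
apply: contraNF tt' => oddt'.
have /card_gt0P[x] : 0 < #|[set x | (x \notin t') & Q (x |: t')]|.
  by case: #|_| oddt'.
rewrite inE => /andP[xt' /andP[/eqP]]; rewrite cardsU1 xt' => ct'I dxt'.
have dt' : dominant t'.
  apply/dominantP => y; have /dominantP/(_ y)[i Hi] := dxt'; exists i => w wt.
  by apply: Hi; rewrite inE wt orbT.
have inlt' z : inl z \notin t'.
  apply/negP => zt'; have := inner_facet_even zt' ct'I dt'.
  suff -> : [set x | (x \notin t') && dominant (x |: t')] =
            [set x | (x \notin t') && Q (x |: t')] by rewrite oddt'.
  apply/setP => w; rewrite !inE; case: (boolP (w \in t')) => //= wt'.
  by rewrite /Q cardsU1 wt' ct'I eqxx.
apply/eqP/setP => x0; apply/idP/imsetP => [|[j ji ->]].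
  case: x0 => [z|j]; first by rewrite (negPf (inlt' z)).
  move=> jt'; exists j => //; rewrite -ct' -(cslack j); exact: imset_f.
have : j \in c @: t' by rewrite ct'.
case/imsetP => -[z|j'] jt'; first by rewrite (negPf (inlt' z)) in jt'.
by rewrite cslack => ->.
Qed.

End Scarf.

(** * Colourings of the lattice points of a simplex *)
Definition grid n N := {k : {ffun 'I_n -> 'I_N.+1} | \sum_i k i == N}.

Section Grid.
Variables n N : nat.
Local Notation T := (grid n N).
Implicit Types k : T.

Definition coord k (i : 'I_n) : nat := val k i.

Lemma sum_coord k : \sum_i coord k i = N.
Proof. exact/eqP/(valP k). Qed.

Lemma coord_le k i : coord k i <= N.
Proof. by rewrite /coord -ltnS. Qed.

Let B := #|{: T}|.
Let idx k : nat := enum_rank k.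

Let idx_lt k : idx k < B.
Proof. exact: ltn_ord. Qed.

Let idx_inj : injective idx.
Proof. by move=> k k' /val_inj/enum_rank_inj. Qed.

(** Lattice points are ordered by their i-th coordinate, ties being broken by
    an enumeration of the lattice so that each order is linear. *)
Definition grid_rank (i : 'I_n) (x : T + 'I_n) : nat :=
  match x with
  | inl k => (coord k i * B + idx k).+1
  | inr j => if i == j then 0 else (N.+1 * B + j).+1
  end.

Lemma grid_rank_lt i k : coord k i * B + idx k < N.+1 * B.
Proof.
have := leq_mul (coord_le k i) (leqnn B).
by have := idx_lt k; rewrite mulSn; lia.
Qed.

Lemma grid_rank_inj i : injective (grid_rank i).
Proof.
move=> [k|j] [k'|j'] /=.
- by move=> [] /(congr1 (modn^~ B)); rewrite !modnMDl !modn_small// => /idx_inj->.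
- case: (i =P j') => // _ [] e; have := grid_rank_lt i k; lia.
- case: (i =P j) => // _ [] e; have := grid_rank_lt i k'; lia.
case: (i =P j) => [<-|ij]; case: (i =P j') => [<-|ij'] //.
by move=> [] e; congr inr; apply/val_inj => /=; lia.
Qed.

Lemma grid_rank_coord i k k' :
  grid_rank i (inl k) <= grid_rank i (inl k') -> coord k i <= coord k' i.
Proof.
rewrite /= ltnS => le; rewrite leqNgt; apply/negP => lt.
have := leq_mul lt (leqnn B); have := idx_lt k'.
by rewrite mulSn; lia.
Qed.

(** In a rainbow dominant set, let m i be the minimum of the i-th coordinate
    over its lattice points, for the indices i in C whose slack point is
    absent.  The sum over C of m i + 1 exceeds N: otherwise a lattice point
    with coordinates at least m i + 1 on C would be dominated by no index.  As
    the coordinates of a lattice point add up to N, all the lattice points of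
    the set have coordinates within n of m i on C, and at most n outside C. *)
Lemma grid_color (color : T -> 'I_n) : 0 < n ->
  exists k0, forall i, coord k0 i <= n \/
    exists2 k, color k = i &
      forall j, coord k j <= coord k0 j + n /\ coord k0 j <= coord k j + n.
Proof.
move=> n_gt0; pose i0 := Ordinal n_gt0.
have smin (i : 'I_n) z : grid_rank i (inr i) < grid_rank i (inl z).
  by rewrite /= eqxx.
have stop (i j : 'I_n) z : i != j -> grid_rank i (inl z) < grid_rank i (inr j).
  by move=> /= /negPf->; have := grid_rank_lt i z; lia.
have z0P : \sum_i [ffun i : 'I_n => inord (if i == i0 then N else 0) : 'I_N.+1] i == N.
  rewrite (bigD1 i0)//= big1 => [|i /negPf ii0]; last first.
    by rewrite ffunE ii0 inordK.
  by rewrite ffunE eqxx inordK// addn0.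
pose mkT := exist (fun k : {ffun 'I_n -> 'I_N.+1} => \sum_i k i == N).
pose z0 : T := mkT _ z0P.
pose c (x : T + 'I_n) := match x with inl k => color k | inr i => i end.
have [s [_ dom cs]] := scarf grid_rank_inj smin stop z0 i0 (c := c) (fun=> erefl).
have {}dom y : exists i, (inr i \notin s) /\
    forall k, inl k \in s -> coord y i <= coord k i.
  have /dominantP/(_ (inl y))[i Hi] := dom; exists i; split.
    by apply/negP => /Hi; rewrite leqNgt smin.
  by move=> k ks; apply: grid_rank_coord; exact: Hi.
have colors i : inr i \notin s -> exists2 k, inl k \in s & color k = i.
  move=> iC; have : i \in c @: s by rewrite cs.
  case/imsetP => -[k|j] js ie; first by exists k.
  by move: iC; rewrite ie js.
have [i1 [i1C _]] := dom z0.
have [k0 k0s _] := colors _ i1C.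
pose mk i := [arg min_(k < k0 | inl k \in s) coord k i].
pose m i := coord (mk i) i.
have mks i : inl (mk i) \in s by rewrite /mk; case: arg_minnP.
have mP i k : inl k \in s -> m i <= coord k i.
  by rewrite /m /mk; case: arg_minnP => // z _ + ks; apply.
pose C := [pred i : 'I_n | inr i \notin s].
have sumC : N < \sum_(i | C i) (m i).+1.
  rewrite ltnNge; apply/negP => le.
  (* The point that contradicts dominance: m i + 1 on C, the surplus d being
     put on one index of C. *)
  pose d := N - \sum_(i | C i) (m i).+1.
  pose y' i := (if C i then (m i).+1 else 0) + (if i == i1 then d else 0).
  have sumy' : \sum_i y' i = N.
    by rewrite big_split/= -!big_mkcond/= big_pred1_eq subnKC.
  have y'N i : y' i < N.+1 by rewrite ltnS -sumy' (bigD1 i)//= leq_addr.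
  have yP : \sum_i [ffun i => Ordinal (y'N i)] i == N.
    by under eq_bigr do rewrite ffunE; rewrite /= sumy'.
  have [i [iC Hi]] := dom (mkT _ yP).
  have := Hi _ (mks i); rewrite /coord/= ffunE/= -/(coord _ _) -/(m i).
  by rewrite /y' /C/= iC; lia.
have cardC : \sum_(i | C i) 1 <= n.
  by rewrite sum1_card -[leqRHS]card_ord max_card.
have close_in k i : inl k \in s -> C i -> coord k i <= m i + n.
  move=> ks iC; have := sum_coord k; rewrite (bigID C)/= => sk.
  have := sumC; under eq_bigr do rewrite -addn1; rewrite big_split/=.
  rewrite (bigD1 i)//= in sk; rewrite (bigD1 i)//=.
  have : \sum_(j | C j && (j != i)) m j <= \sum_(j | C j && (j != i)) coord k j.
    by apply: leq_sum => j _; exact: mP.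
  move: cardC sk; rewrite /C/=; lia.
have close_out k i : inl k \in s -> ~~ C i -> coord k i <= n.
  move=> ks iC; have := sum_coord k; rewrite (bigID C)/= => sk.
  have := sumC; under eq_bigr do rewrite -addn1; rewrite big_split/=.
  rewrite [X in _ + X](bigD1 i)//= in sk.
  have : \sum_(j | C j) m j <= \sum_(j | C j) coord k j.
    by apply: leq_sum => j _; exact: mP.
  move: cardC sk; rewrite /C/=; lia.
exists k0 => i; have [iC|iC] := boolP (C i); last by left; exact: close_out.
have [k ks <-] := colors _ iC; right; exists k => // j.
have [jC|jC] := boolP (C j).
  have := close_in k _ ks jC; have := close_in k0 _ k0s jC.
  have := mP j _ ks; have := mP j _ k0s; lia.
have := close_out k _ ks jC; have := close_out k0 _ k0s jC; lia.
Qed.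

End Grid.

From mathcomp Require Import all_classical all_reals all_analysis.
From mathcomp Require Import measurable_realfun ring lra.

Import Order.TTheory GRing.Theory Num.Theory.
Import numFieldNormedType.Exports.

Local Open Scope classical_set_scope.
Local Open Scope ring_scope.

(** * Brouwer's theorem *)
Section Cluster.
Variables (R : realType) (J : eqType).

Lemma near_proj (u : prod_topology (fun _ : J => R)) (s : seq J) (e : R) : 0 < e ->
  nbhs u [set v : prod_topology (fun _ : J => R) | forall j, j \in s -> `|v j - u j| < e].
Proof.
move=> e0; elim: s => [|j s IHs].
  by apply: (@filterS _ _ _ setT); [by move=> v _ j|exact: filterT].
have H : nbhs u [set v : prod_topology (fun _ : J => R) | `|v j - u j| < e].
  have := @proj_continuous J (fun=> R) j u.
  move=> /(_ [set y | `|y - u j| < e]); apply.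
  by apply: filterS (@nbhsx_ballx _ R (u j) e e0) => y; rewrite /ball/= distrC.
apply: filterS2 H IHs => v vj vs i; rewrite inE => /orP[/eqP->//|].
exact: vs.
Qed.

(** The index set J is arbitrary: it is finite for Brouwer's theorem, and the
    real line for the fixed point theorem in function spaces. *)
Lemma cube_cluster (M : R) (E : nat -> J -> R) :
  (forall n j, 0 <= E n j <= M) ->
  exists u : J -> R, (forall j, 0 <= u j <= M) /\
    forall (s : seq J) (e : R) (N : nat), 0 < e ->
      exists2 n, (N <= n)%N & forall j, j \in s -> `|E n j - u j| < e.
Proof.
move=> EM.
have := @tychonoff J (fun=> R) (fun=> `[0, M]%classic) (fun=> @segment_compact _ 0 M).
move=> /(_ (E @ \oo)) [|u [uM clu]].
  by exists 0%N => // n _ j /=; rewrite in_itv/= EM.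
exists u; split=> [j|s e N e0].
  by have := uM j; rewrite /= in_itv.
have nE : (E @ \oo) [set v | exists2 n, (N <= n)%N & v = E n].
  by exists N => // n /= Nn; exists n.
have [_ [[n Nn ->] H]] := clu _ _ nE (near_proj u s e0).
by exists n.
Qed.
End Cluster.

Section Brouwer.
Variable R : realType.

Definition simplex n (x : 'I_n -> R) : Prop :=
  (forall i, 0 <= x i) /\ \sum_i x i = 1.

Lemma simplex_le1 n (x : 'I_n -> R) i : simplex x -> 0 <= x i <= 1.
Proof.
move=> [x0 x1]; rewrite x0/= -x1 (bigD1 i)//= lerDl.
by apply: sumr_ge0 => j _.
Qed.

(** A lattice point x is given a colour i with x i <= F x i, which exists as
    the coordinates of x and of F x have the same sum. *)
Lemma approx_fixpoint n (F : ('I_n.+1 -> R) -> 'I_n.+1 -> R) (N : nat) :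
  (forall x, simplex x -> simplex (F x)) ->
  let c : R := n.+1%:R / N.+1%:R in
  exists y, simplex y /\
    forall i, y i <= c \/ exists z, [/\ simplex z, z i <= F z i &
      forall j, `|z j - y j| <= c].
Proof.
move=> FD c.
pose pt (k : grid n.+1 N.+1) (i : 'I_n.+1) : R := (coord k i)%:R / N.+1%:R.
have ptD k : simplex (pt k).
  split=> [i|]; first by rewrite divr_ge0.
  by rewrite -mulr_suml -natr_sum sum_coord divff.
pose color k := odflt ord0 [pick i | pt k i <= F (pt k) i].
have colorP k : pt k (color k) <= F (pt k) (color k).
  rewrite /color; case: pickP => //= H.
  have [_ s1] := ptD k; have [_ s2] := FD _ (ptD k).
  suff : \sum_i F (pt k) i < \sum_i pt k i by rewrite s1 s2 ltxx.
  apply: ltr_sum => [|i _]; last by rewrite ltNge H.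
  by apply/hasP; exists ord0; rewrite ?mem_index_enum.
have [k0 Hk0] := grid_color color (ltn0Sn n).
exists (pt k0); split; first exact: ptD.
move=> i; case: (Hk0 i) => [le|[k <- close]]; [left|right].
  by rewrite ler_pM2r// ler_nat.
exists (pt k); split => // j.
rewrite /pt -mulrBl normrM [X in _ * X]ger0_norm// ler_pM2r//.
have [c1 c2] := close j; rewrite ler_norml; apply/andP; split.
  by rewrite lerBrDr addrC lerBlDr -natrD ler_nat.
by rewrite lerBlDr addrC -natrD ler_nat.
Qed.

(** At a cluster point x of the approximate solutions, continuity gives
    x i <= F x i for every i, and equality follows as both sides have
    sum 1. *)
Lemma brouwer_simplex n (F : ('I_n.+1 -> R) -> 'I_n.+1 -> R) :
  (forall x, simplex x -> simplex (F x)) ->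
  (forall x, simplex x -> forall e, 0 < e -> exists2 d, 0 < d &
    forall y, simplex y -> (forall i, `|y i - x i| < d) ->
      forall i, `|F y i - F x i| < e) ->
  exists2 x, simplex x & F x =1 x.
Proof.
move=> FD Fc.
have /choice[E EP] := fun N => approx_fixpoint N FD.
have E01 N j : 0 <= E N j <= 1 by apply: simplex_le1; case: (EP N).
have [x [x01 clx]] := cube_cluster E01.
have clx' e N : 0 < e -> exists2 m, (N <= m)%N & forall j, `|E m j - x j| < e.
  move=> e0; have [m Nm H] := clx (enum 'I_n.+1) e N e0; exists m => // j.
  by apply: H; rewrite mem_enum.
have xD : simplex x.
  split=> [i|]; first by case/andP: (x01 i).
  apply/eqP; rewrite -subr_eq0 -normr_le0; apply/ler_addgt0Pl => e e0.
  rewrite addr0; have e'0 : 0 < e / n.+1%:R by rewrite divr_gt0.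
  have [m _ H] := clx' _ 0%N e'0; have [[_ sE] _] := EP m.
  rewrite -sE -sumrB; apply: le_trans (ler_norm_sum _ _ _) _.
  apply: (@le_trans _ _ (\sum_(i < n.+1) e / n.+1%:R)).
    by apply: ler_sum => i _; rewrite distrC ltW.
  by rewrite sumr_const card_ord -(mulr_natr (e / _)) divfK.
have xF i : x i <= F x i.
  apply/ler_addgt0Pl => e e0; have e3 : 0 < e / 4 by rewrite divr_gt0.
  have [d d0 Hd] := Fc x xD _ e3.
  pose r := Num.min (d / 2) (e / 4).
  have r0 : 0 < r by rewrite lt_min e3 andbT divr_gt0.
  have rd : r <= d / 2 by rewrite ge_min lexx.
  have re : r <= e / 4 by rewrite ge_min lexx orbT.
  have [N HN] : exists N : nat, forall m, (N <= m)%N -> n.+1%:R / m.+1%:R < r :> R.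
    exists (Num.truncn (n.+1%:R / r)) => m Nm.
    rewrite ltr_pdivrMr// mulrC -ltr_pdivrMr//.
    apply: lt_le_trans (truncnS_gt _) _.
    by rewrite ler_nat ltnS.
  have [m Nm H] := clx' r N r0.
  have [_ /(_ i)] := EP m; have := HN m Nm; set c := _ / _ => cr.
  have := H i; rewrite ltr_norml => /andP[E1 E2].
  have Fi0 : 0 <= F x i by case: (FD x xD).
  case=> [Ei|[z [zD zF zE]]]; first by lra.
  have zx j : `|z j - x j| < d.
    have -> : z j - x j = (z j - E m j) + (E m j - x j) by ring.
    apply: le_lt_trans (ler_normD _ _) _.
    have := zE j; have := H j; lra.
  have := Hd z zD zx i; have := zE i; rewrite ltr_norml ler_norml; lra.
exists x => // i; apply/eqP; rewrite eq_le xF andbT.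
have [_ sx] := xD; have [_ sF] := FD x xD.
have : \sum_j (F x j - x j) = 0 by rewrite sumrB sF sx subrr.
move/eqP; rewrite psumr_eq0 => [/allP/(_ i)|j _]; last by rewrite subr_ge0.
by rewrite mem_index_enum => /(_ isT); rewrite subr_eq0 => /eqP->.
Qed.

(** The n coordinates, divided by (n + 1) M, are completed by a slack coordinate
    into a point of a simplex.  Every image has coordinates at most M, so its
    slack coordinate is positive. *)
Lemma brouwer_box n (M : R) (F : ('I_n -> R) -> 'I_n -> R) : 0 < M ->
  (forall x, (forall i, 0 <= x i) -> forall i, 0 <= F x i <= M) ->
  (forall x, (forall i, 0 <= x i) -> forall e, 0 < e -> exists2 d, 0 < d &
    forall y, (forall i, 0 <= y i) -> (forall i, `|y i - x i| < d) ->
      forall i, `|F y i - F x i| < e) ->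
  exists2 x, (forall i, 0 <= x i) & F x =1 x.
Proof.
move=> M0 FM Fc.
pose K : R := n.+1%:R * M.
have K0 : 0 < K by rewrite mulr_gt0.
pose x_ (y : 'I_n.+1 -> R) (i : 'I_n) : R := K * y (lift ord0 i).
pose H (y : 'I_n.+1 -> R) (i : 'I_n.+1) : R :=
  if unlift ord0 i is Some j then F (x_ y) j / K
  else 1 - \sum_j F (x_ y) j / K.
have Hlift y i : H y (lift ord0 i) = F (x_ y) i / K by rewrite /H liftK.
have H0 y : H y ord0 = 1 - \sum_j F (x_ y) j / K by rewrite /H unlift_none.
have x_ge0 y : simplex y -> forall i, 0 <= x_ y i.
  by move=> [y0 _] i; rewrite mulr_ge0// ltW.
have HD y : simplex y -> simplex (H y).
  move=> yD; have F01 := FM _ (x_ge0 y yD); split.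
    move=> i; have [j ->|->] := unliftP ord0 i.
      by rewrite Hlift divr_ge0 ?(ltW K0)//; case/andP: (F01 j).
    rewrite H0 subr_ge0 -mulr_suml ler_pdivrMr// mul1r.
    apply: (@le_trans _ _ (\sum_(j < n) M)).
      by apply: ler_sum => j _; case/andP: (F01 j).
    by rewrite sumr_const card_ord -(mulr_natl M) ler_pM2r// ler_nat.
  rewrite big_ord_recl H0; under [X in _ + X]eq_bigr do rewrite Hlift.
  by rewrite subrK.
have [||y yD Hy] := @brouwer_simplex n H => //.
  move=> y yD e e0; have e'0 : 0 < Num.min 1 (e * M) by rewrite lt_min ltr01 mulr_gt0.
  have [d d0 Hd] := Fc _ (x_ge0 y yD) _ e'0.
  exists (d / K); first by rewrite divr_gt0.
  move=> z zD zy.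
  have Fz i : `|F (x_ z) i / K - F (x_ y) i / K| < e / n.+1%:R.
    rewrite -mulrBl normrM [X in _ * X]gtr0_norm ?invr_gt0//.
    rewrite ltr_pdivrMr// (_ : e / _ * K = e * M); last first.
      by rewrite /K mulrA divfK.
    have := Hd _ (x_ge0 z zD) _ i; rewrite lt_min => /(_ _)/andP[|_ ->//] j.
    rewrite /x_ -mulrBr normrM gtr0_norm// mulrC -ltr_pdivlMr//.
  have lte i : `|F (x_ z) i / K - F (x_ y) i / K| < e.
    apply: lt_le_trans (Fz i) _; rewrite ler_pdivrMr// ler_peMr ?ler1n// ltW//.
  move=> i; have [j ->|->] := unliftP ord0 i; first by rewrite !Hlift.
  rewrite !H0 opprB addrC addrA subrK -sumrB.
  apply: le_lt_trans (ler_norm_sum _ _ _) _.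
  apply: (@le_lt_trans _ _ (\sum_(i < n) e / n.+1%:R)).
    by apply: ler_sum => j _; rewrite distrC ltW.
  rewrite sumr_const card_ord -(mulr_natr (e / _)) mulrAC ltr_pdivrMr// ltr_pM2l//.
  by rewrite ltr_nat.
exists (x_ y); first exact: x_ge0.
by move=> i; rewrite {2}/x_ -Hy Hlift mulrC divfK// gt_eqF.
Qed.

End Brouwer.

(** * A fixed point theorem for equicontinuous operators *)
Section Schauder.
Variable R : realType.
Implicit Types u v : R -> R.

Definition nncont u : Prop :=
  {within `[0, 1], continuous u} /\ {in `[0, 1], forall t, 0 <= u t}.

Lemma unit_net (d : R) : 0 < d -> exists s : seq R,
  (forall x, x \in s -> x \in `[0, 1]) /\
  (forall t, t \in `[0, 1] -> exists2 x, x \in s & `|t - x| < d).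
Proof.
move=> d0; pose n := Num.truncn d^-1.
have nd : n.+1%:R^-1 < d.
  by rewrite invf_plt ?posrE// truncnS_gt.
pose s := [seq i%:R / n.+1%:R : R | i <- iota 0 n.+2]; exists s; split.
  move=> x /mapP[i]; rewrite mem_iota add0n ltnS => ile ->.
  by rewrite in_itv/= divr_ge0//= ler_pdivrMr// mul1r ler_nat.
move=> t; rewrite in_itv/= => /andP[t0 t1].
pose i := Num.truncn (t * n.+1%:R).
have tn0 : 0 <= t * n.+1%:R by rewrite mulr_ge0.
have /andP[i1 i2] := truncn_itv tn0.
exists (i%:R / n.+1%:R).
  apply: (map_f (fun i : nat => i%:R / n.+1%:R)); rewrite mem_iota add0n ltnS/=.
  rewrite -(ler_nat R); apply: le_trans i1 _.
  by rewrite ler_piMl// ler_nat.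
apply: lt_trans nd; rewrite ger0_norm.
  by rewrite ltrBlDl -[X in _ + X]mul1r -mulrDl ltr_pdivlMr// natr1.
by rewrite subr_ge0 ler_pdivrMr.
Qed.

(** Normalized bump functions centred at the nodes s form a partition of unity
    on [0, 1]; [interp x] is the combination with coefficients x, so it stays
    close to any value that is close to the x i at the nearby nodes. *)
Section Interpolation.
Variables (n : nat) (s : 'I_n -> R) (d : R).
Hypothesis sd : forall t, t \in `[0, 1] -> exists i, `|t - s i| < d.

Definition bump (i : 'I_n) (t : R) : R := Num.max 0 (d - `|t - s i|).

Definition interp (x : 'I_n -> R) (t : R) : R :=
  (\sum_i x i * bump i t) / \sum_i bump i t.

Lemma bump_ge0 i t : 0 <= bump i t.
Proof. by rewrite le_max lexx. Qed.

Lemma sum_bump_gt0 t : t \in `[0, 1] -> 0 < \sum_i bump i t.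
Proof.
move=> /sd[i ti]; rewrite (bigD1 i)//= ltr_pwDl//.
  by rewrite lt_max subr_gt0 ti orbT.
by apply: sumr_ge0 => j _; exact: bump_ge0.
Qed.

Lemma bump_continuous i : continuous (bump i).
Proof.
move=> t; have := @continuous_max _ _ (cst 0 : R -> R^o) (fun t : R => d - `|t - s i| : R^o) t.
apply; first exact: cvg_cst.
apply: cvgB; first exact: cvg_cst.
by apply: cvg_norm; apply: cvgB; [exact: cvg_id|exact: cvg_cst].
Qed.

Lemma interp_nncont x : (forall i, 0 <= x i) -> nncont (interp x).
Proof.
move=> x0; split.
  apply: continuous_in_subspaceT => t; rewrite inE/= => t01.
  apply: cvgM; last apply: cvgV.
  - apply: (cvg_big (op := +%R)) => [|i _]; first exact: add_continuous; apply: cvgM; [exact: cvg_cst|exact: bump_continuous].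
  - by rewrite gt_eqF// sum_bump_gt0.
  - apply: (cvg_big (op := +%R)) => [|i _]; first exact: add_continuous; exact: bump_continuous.
move=> t t01; rewrite divr_ge0// ?(ltW (sum_bump_gt0 t01))//.
by apply: sumr_ge0 => i _; rewrite mulr_ge0// bump_ge0.
Qed.

Lemma interp_near x t (y e : R) : t \in `[0, 1] ->
  (forall i, `|t - s i| < d -> `|x i - y| <= e) -> `|interp x t - y| <= e.
Proof.
move=> t01 xy; have S0 := sum_bump_gt0 t01; rewrite /interp.
have -> : (\sum_i x i * bump i t) / (\sum_i bump i t) - y =
    (\sum_i (x i - y) * bump i t) / (\sum_i bump i t).
  under [in RHS]eq_bigr do rewrite mulrBl.
  by rewrite sumrB -mulr_sumr mulrBl -mulrA divff ?mulr1// gt_eqF.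
rewrite normrM normfV (gtr0_norm S0) ler_pdivrMr// mulr_sumr.
apply: le_trans (ler_norm_sum _ _ _) _; apply: ler_sum => i _.
rewrite normrM (ger0_norm (bump_ge0 _ _)).
have [ti|ti] := ltP `|t - s i| d; first by rewrite ler_wpM2r ?bump_ge0// xy.
have -> : bump i t = 0 by rewrite /bump max_l// subr_le0.
by rewrite !mulr0.
Qed.

End Interpolation.

Variables (Phi : (R -> R) -> R -> R) (M : R).
Hypothesis M0 : 0 < M.
Hypothesis PhiM : forall u, nncont u ->
  forall t, t \in `[0, 1] -> 0 <= Phi u t <= M.
Hypothesis Phi_equi : forall e, 0 < e -> exists2 d, 0 < d &
  forall u, nncont u -> forall s t, s \in `[0, 1] -> t \in `[0, 1] ->
    `|s - t| < d -> `|Phi u s - Phi u t| <= e.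
Hypothesis Phi_cont : forall u, nncont u -> forall e, 0 < e -> exists2 d, 0 < d &
  forall v, nncont v -> (forall t, t \in `[0, 1] -> `|v t - u t| <= d) ->
    forall t, t \in `[0, 1] -> `|Phi v t - Phi u t| <= e.

(** Brouwer's theorem is applied to the map that sends nodal values x to the
    nodal values of Phi (interp x).  By equicontinuity, Phi (interp x) is close
    to the interpolant of its nodal values, which is interp x itself when x is
    fixed. *)
Lemma schauder_approx (e : R) : 0 < e ->
  exists2 v, nncont v & forall t, t \in `[0, 1] -> `|Phi v t - v t| <= e.
Proof.
move=> e0; have [d d0 Hd] := Phi_equi e0.
have [s [s01 snet]] := unit_net d0.
pose n := size s; pose nd (i : 'I_n) := nth 0 s i.
have nd01 i : nd i \in `[0, 1] by apply: s01; exact: mem_nth.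
have ndd t : t \in `[0, 1] -> exists i, `|t - nd i| < d.
  move=> /snet[x xs tx]; have xn : (index x s < n)%N by rewrite index_mem.
  by exists (Ordinal xn); rewrite /nd/= nth_index.
pose P := interp nd d.
have [||x x0 Fx] := @brouwer_box R n M (fun x i => Phi (P x) (nd i)) M0.
- by move=> x x0 i; apply: PhiM => //; exact: interp_nncont.
- move=> x x0 r r0; have Px := interp_nncont ndd x0.
  have r2 : 0 < r / 2 by rewrite divr_gt0.
  have [c c0 Hc] := Phi_cont Px r2.
  exists c => // y y0 yx i; have Py := interp_nncont ndd y0.
  apply: (@le_lt_trans _ _ (r / 2)); last by lra.
  apply: Hc => // t t01.
  have S0 := sum_bump_gt0 ndd t01.
  rewrite /interp -mulrBl -sumrB normrM normfV (gtr0_norm S0) ler_pdivrMr// mulr_sumr.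
  apply: le_trans (ler_norm_sum _ _ _) _; apply: ler_sum => j _.
  by rewrite -mulrBl normrM (ger0_norm (bump_ge0 _ _ _ _)) ler_wpM2r ?bump_ge0// ltW.
exists (P x); first exact: interp_nncont.
move=> t t01; rewrite distrC; apply: interp_near => // i ti.
by rewrite -Fx; apply: Hd => //; [exact: interp_nncont|rewrite distrC].
Qed.

(** The approximate fixed points cluster pointwise, by Tychonoff.
    Equicontinuity passes to the limit u and turns closeness on a finite net
    into uniform closeness, so that the continuity of Phi at u applies. *)
Lemma schauder : exists2 u, nncont u & {in `[0, 1], forall t, u t = Phi u t}.
Proof.
have /choice[V HV] : forall k : nat, exists v, nncont v /\
    forall t, t \in `[0, 1] -> `|Phi v t - v t| <= k.+1%:R^-1.
  move=> k; have [|v ? ?] := @schauder_approx k.+1%:R^-1; first by rewrite invr_gt0.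
  by exists v.
have VN k : nncont (V k) by case: (HV k).
(* Off [0, 1] the values of Phi are not controlled; they are replaced by 0. *)
pose E k t := if t \in `[0, 1] then Phi (V k) t else 0.
have EM k t : 0 <= E k t <= M.
  by rewrite /E; case: ifPn => [t01|_]; [exact: PhiM|rewrite lexx ltW].
have [u [uM clu]] := cube_cluster EM.
have Ein k t : t \in `[0, 1] -> E k t = Phi (V k) t by rewrite /E => ->.
have u_equi e : 0 < e -> exists2 d, 0 < d & forall s t,
    s \in `[0, 1] -> t \in `[0, 1] -> `|s - t| < d -> `|u s - u t| <= e.
  move=> e0; have e2 : 0 < e / 2 by rewrite divr_gt0.
  have [d d0 Hd] := Phi_equi e2; exists d => // s t s01 t01 st.
  have e4 : 0 < e / 4 by rewrite divr_gt0.
  have [k _ Hk] := clu [:: s; t] _ 0%N e4.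
  have tst : t \in [:: s; t] by rewrite !inE eqxx orbT.
  have /ltW := Hk s (mem_head _ _); have /ltW := Hk t tst; rewrite !Ein//.
  have := Hd _ (VN k) s t s01 t01 st; rewrite !ler_norml; lra.
have uN : nncont u.
  split; last by move=> t _; case/andP: (uM t).
  apply/subspace_continuousP => t t01; apply/cvgrPdist_le => e e0.
  have [d d0 Hd] := u_equi e e0.
  rewrite near_withinE; near=> s => s01.
  apply: Hd => //; near: s; exact: nbhsx_ballx.
exists u => // t t01; apply/eqP; rewrite -subr_eq0 -normr_le0.
apply/ler_addgt0Pl => e e0; rewrite addr0.
have e3 : 0 < e / 3 by rewrite divr_gt0.
have [d d0 Hd] := Phi_cont uN e3.
pose r := Num.min (d / 4) (e / 3).
have r0 : 0 < r by rewrite lt_min e3 andbT divr_gt0.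
have rd : r <= d / 4 by rewrite ge_min lexx.
have re : r <= e / 3 by rewrite ge_min lexx orbT.
have [d1 d10 Hd1] := Phi_equi r0.
have [d2 d20 Hd2] := u_equi _ r0.
pose d3 := Num.min d1 d2.
have d30 : 0 < d3 by rewrite lt_min d10.
have [s [s01 snet]] := unit_net d30.
have [k kr Hk] := clu (t :: s) r (Num.truncn r^-1) r0.
have kr' : k.+1%:R^-1 <= r.
  rewrite invf_ple ?posrE//; apply: le_trans (ltW (truncnS_gt _)) _.
  by rewrite ler_nat ltnS.
have [_ HVk] := HV k.
have close x : x \in `[0, 1] -> `|V k x - u x| <= d.
  move=> x01; have [y ys xy] := snet _ x01.
  have y01 := s01 _ ys.
  have xy1 : `|x - y| < d1 by apply: lt_le_trans xy _; rewrite ge_min lexx.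
  have xy2 : `|x - y| < d2 by apply: lt_le_trans xy _; rewrite ge_min lexx orbT.
  have H1 := Hd1 _ (VN k) x y x01 y01 xy1.
  have H2 := Hd2 x y x01 y01 xy2.
  have H3 : `|Phi (V k) y - u y| < r by rewrite -Ein//; apply: Hk; rewrite inE ys orbT.
  have H4 := le_trans (HVk x x01) kr'.
  move: H1 H2 (ltW H3) H4; rewrite !ler_norml; lra.
have H1 := Hd _ (VN k) close t t01.
have := ltW (Hk t (mem_head _ _)); rewrite Ein//.
move: H1; rewrite !ler_norml; lra.
Unshelve. all: by end_near. Qed.

End Schauder.

(** * The reflection s |-> 1 - s *)
Section Reflection.
Variable R : realType.
Notation mu := (@lebesgue_measure R).

Lemma preimage_reflect (b0 b1 : bool) (x y : R) :
  (fun s : R => 1 - s) @^-1` [set` Interval (BSide b0 x) (BSide b1 y)] =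
  [set` Interval (BSide (~~ b1) (1 - y)) (BSide (~~ b0) (1 - x))].
Proof.
apply/seteqP; split => s /=; case: b0; case: b1; rewrite !in_itv/=;
  by move=> /andP[H1 H2]; apply/andP; split; move: H1 H2; lra.
Qed.

Lemma measurable_reflect :
  measurable_fun [set: R] ((fun s : R => 1 - s) : R -> measurableTypeR R).
Proof. by apply: measurable_funB; [exact: measurable_cst|exact: measurable_id]. Qed.

Lemma lebesgue_measure_reflect (A : set R) : measurable A ->
  pushforward mu ((fun s : R => 1 - s) : R -> measurableTypeR R) A = mu A.
Proof.
move=> mA; apply/esym/lebesgue_measure_unique => //=.
  exact: measurable_reflect.
move=> _ ? [[a b]] _ <-.
rewrite /pushforward preimage_reflect/= !lebesgue_measure_itv/=.
rewrite !lte_fin; have -> : (1 - b < 1 - a) = (a < b) by rewrite ltrD2l ltrN2.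
by case: ifP => // _; congr (_%:E); ring.
Qed.

Lemma integrable_reflect (g : R -> R) :
  mu.-integrable `]0, 1] (EFin \o g) ->
  mu.-integrable `[0, 1] (EFin \o (fun s => g (1 - s))).
Proof.
move=> /integrableP[mg ig].
pose phi : R -> measurableTypeR R := fun s => 1 - s.
have pre : phi @^-1` `]0, 1] = `[0, 1[%classic.
  by rewrite /phi preimage_reflect/= subrr subr0.
have mg' : measurable_fun (`[0, 1[%classic : set (measurableTypeR R)) (EFin \o (fun s : R => g (1 - s))).
  have -> : EFin \o (fun s : R => g (1 - s)) = (EFin \o g) \o phi by [].
    apply: (@measurable_comp _ _ _ (measurableTypeR R) (measurableTypeR R) (\bar R) `]0, 1]%classic (EFin \o g) `[0, 1[%classic phi) => //.
    by rewrite -pre => _ [s ps <-].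
  exact: measurable_funTS measurable_reflect.
apply/integrableP; split; first exact/emeasurable_fun_itv_bndo_bndcP.
rewrite -integral_itv_bndo_bndc; last exact: measurableT_comp.
rewrite -pre -(@ge0_integral_pushforward _ _ (measurableTypeR R) (measurableTypeR R) R phi _ mu _ (fun y => `|(g y)%:E|%E))//.
- apply: le_lt_trans ig; rewrite le_eqVlt; apply/orP; left; apply/eqP.
  apply: eq_measure_integral => /=; first exact: measurable_reflect.
  by move=> _ A mA _; exact: lebesgue_measure_reflect.
- exact: measurable_reflect.
- exact: measurableT_comp.
Qed.

Lemma ae_reflect (P : R -> Prop) :
  {ae mu, forall t, t \in `]0, 1] -> P t} ->
  {ae mu, forall s, s \in `[0, 1[ -> P (1 - s)}.
Proof.
move=> [N [mN N0 sub]].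
exists ((fun s : R => 1 - s) @^-1` N); split.
- by rewrite -[X in measurable X]setTI; exact: measurable_reflect.
- by rewrite -N0; exact: lebesgue_measure_reflect.
move=> s /= nP; apply: sub => /= H; apply: nP => s01; apply: H.
by move: s01; rewrite !in_itv/= => /andP[? ?]; apply/andP; split; lra.
Qed.

End Reflection.

(** * Extrema and uniform continuity on compact sets *)
Section Extrema.
Variables (R : realType) (T : Type) (D : set T) (h : T -> R).

Lemma le_max_on (M : R) x : (forall y, D y -> h y <= M) -> D x -> h x <= max_on D h.
Proof.
move=> hM Dx; apply: ub_le_sup; last by exists x.
by exists M => _ [y Dy <-]; exact: hM.
Qed.

Lemma max_on_le c x : D x -> (forall y, D y -> h y <= c) -> max_on D h <= c.
Proof. by move=> Dx hc; apply: ge_sup; [exists (h x), x|move=> _ [y Dy <-]; exact: hc]. Qed.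

Lemma min_on_le (m : R) x : (forall y, D y -> m <= h y) -> D x -> min_on D h <= h x.
Proof.
move=> hm Dx; apply: ge_inf; last by exists x.
by exists m => _ [y Dy <-]; exact: hm.
Qed.

Lemma le_min_on c x : D x -> (forall y, D y -> c <= h y) -> c <= min_on D h.
Proof. by move=> Dx hc; apply: lb_le_inf; [exists (h x), x|move=> _ [y Dy <-]; exact: hc]. Qed.

End Extrema.

Section Compactness.
Variable R : realType.

Lemma compact_image_bounded (T : topologicalType) (K : set T) (h : T -> R) :
  compact K -> {within K, continuous h} ->
  exists2 M, 0 <= M & forall x, K x -> `|h x| <= M.
Proof.
move=> cK ch; have := compact_bounded (continuous_compact ch cK).
case=> M [_ /(_ (Num.max 0 (M + 1)))] H.
exists (Num.max 0 (M + 1)); first by rewrite le_max lexx.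
move=> x Kx; apply: H; last by exists x.
by rewrite lt_max ltrDl ltr01 orbT.
Qed.

Lemma heine (K : set (R * R)) (h : R -> R -> R) (e : R) :
  compact K -> {within K, continuous (uncurry h)} -> 0 < e ->
  exists2 d, 0 < d & forall x y x' y', K (x, y) -> K (x', y') ->
    `|x - x'| < d -> `|y - y'| < d -> `|h x y - h x' y'| < e.
Proof.
move=> /compact_near_coveringP cK /subspace_continuousP ch e0.
have := cK R (0^'+) (fun d z => K z -> forall z' : R * R, K z' ->
  `|z.1 - z'.1| < d -> `|z.2 - z'.2| < d -> `|h z.1 z.2 - h z'.1 z'.2| < e) _.
case.
  move=> [x y] Kxy.
  have e2 : 0 < e / 2 by rewrite divr_gt0.
  have := ch _ Kxy; move=> /cvgrPdist_lt/(_ _ e2).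
  rewrite near_withinE => -[[A1 A2]/= [/nbhs_ballP[r1 r10 A1r] /nbhs_ballP[r2 r20 A2r]] AP].
  pose r := Num.min r1 r2 / 2.
  have m0 : 0 < Num.min r1 r2 by rewrite lt_min r10.
  have r0 : 0 < r by rewrite divr_gt0.
  have rr1 : r + r <= r1 by rewrite /r -splitr ge_min lexx.
  have rr2 : r + r <= r2 by rewrite /r -splitr ge_min lexx orbT.
  exists (ball (x, y) r, [set d | d < r]).
    split; first exact: nbhsx_ballx.
    exact: nbhs_right_lt.
  move=> [[a b] d]/= [[xa yb] dr] Kab [a' b'] Kab' aa' bb'/=.
  rewrite /ball/= in xa yb.
  have in1 u v : `|x - u| < r1 -> `|y - v| < r2 -> K (u, v) -> `|h x y - h u v| < e / 2.
    move=> xu yv Kuv; apply: (AP (u, v)) => //=; split; [exact: A1r|exact: A2r].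
  have H1 := in1 a b _ _ Kab.
  have H2 := in1 a' b' _ _ Kab'.
  have xa' : `|x - a'| < r1.
    rewrite -(subrKA a); apply: le_lt_trans (ler_normD _ _) _.
    by apply: lt_le_trans rr1; rewrite ltrD// (lt_trans aa').
  have yb' : `|y - b'| < r2.
    rewrite -(subrKA b); apply: le_lt_trans (ler_normD _ _) _.
    by apply: lt_le_trans rr2; rewrite ltrD// (lt_trans bb').
  have xar : `|x - a| < r1 by apply: lt_le_trans rr1; rewrite ltr_wpDr// ltW.
  have ybr : `|y - b| < r2 by apply: lt_le_trans rr2; rewrite ltr_wpDr// ltW.
  have := H1 xar ybr; have := H2 xa' yb'; rewrite !ltr_norml; lra.
move=> d0 /= d0P.
move=> Hd; exists (d0 / 2); first by rewrite divr_gt0.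
move=> x y x' y' Kxy Kxy' xx' yy'.
have d2 : 0 < d0 / 2 by rewrite divr_gt0.
have d20 : ball_ Num.norm 0 d0 (d0 / 2).
  by rewrite /ball_/= sub0r normrN gtr0_norm// ltr_pdivrMr// ltr_pMr// ltr1n.
by have := Hd _ d20 d2 _ Kxy Kxy (x', y') Kxy' xx' yy'.
Qed.

(** At points with x > 0 the power is expR (p * ln x); at x = 0 it is small
    near 0 uniformly in the exponent since x ^ p <= x ^ pm for x <= 1. *)
Lemma continuous_powR2 (pm pp : R) : 0 < pm ->
  {within `[pm, pp] `*` `[0, +oo[, continuous (uncurry (fun p x : R => x `^ p))}.
Proof.
move=> pm0; apply/subspace_continuousP => -[p x] /= [].
rewrite !in_itv/= andbT => /andP[pmp ppp]; rewrite le_eqVlt => /predU1P[<-|x0].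
  rewrite /from_subspace.
  have -> : uncurry (fun p x : R => x `^ p) (p, 0) = 0.
    by rewrite /uncurry/= powR0// gt_eqF// (lt_le_trans pm0).
  apply/cvgrPdist_le => e e0; rewrite near_withinE.
  pose d := Num.min 1 (e `^ pm^-1).
  have d0 : 0 < d by rewrite lt_min ltr01 powR_gt0.
  exists ([set: R], ball (0 : R) d).
    by split => /=; [exact: filterT|exact: nbhsx_ballx].
  move=> [p' x']/= [_]; rewrite /ball/= sub0r normrN => x'd [].
  rewrite !in_itv/= andbT => /andP[pmp' _] x'0; rewrite sub0r normrN ger0_norm ?powR_ge0//.
  move: x'd; rewrite ger0_norm// lt_min => /andP[x'1 x'e].
  move: x'0; rewrite le_eqVlt => /predU1P[<-|x'0].
    by rewrite powR0 ?ltW// gt_eqF// (lt_le_trans pm0).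
  apply: (@le_trans _ _ (x' `^ pm)).
    by apply: ger_powR => //; rewrite x'0 ltW.
  have -> : e = (e `^ pm^-1) `^ pm by rewrite -powRrM mulVf ?gt_eqF// powRr1// ltW.
  by rewrite ge0_ler_powR ?nnegrE ?powR_ge0 ?ltW.
rewrite /from_subspace; apply: cvg_within_filter.
have -> : uncurry (fun p x : R => x `^ p) (p, x) = expR (p * ln x).
  by rewrite /uncurry/= /powR gt_eqF.
apply: (@cvg_trans _ ((fun z : R * R => expR (z.1 * ln z.2)) @ (p, x))).
  apply: near_eq_cvg; exists ([set: R], [set y | 0 < y]).
    by split => /=; [exact: filterT|exact: lt_nbhsr].
  by move=> [p' x']/= [_ x'0]; rewrite /powR gt_eqF.
apply: (@cvg_comp _ _ _ (fun z : R * R => z.1 * ln z.2) expR (nbhs (p, x))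
    (nbhs (p * ln x))); last exact: continuous_expR.
apply: cvgM; first exact: cvg_fst.
apply: (@cvg_comp _ _ _ (fun z : R * R => z.2) (@ln R) (nbhs (p, x)) (nbhs x)).
  exact: cvg_snd.
exact: continuous_ln.
Qed.

End Compactness.

(** * Integration over subintervals of [0, 1] *)
Section Integration.
Variable R : realType.
Notation mu := (@lebesgue_measure R).
Implicit Types f g h B : R -> R.

(** The class of densities that is used for the truncated problem, whose
    integrand is only piecewise continuous. *)
Definition bmeas h : Prop :=
  measurable_fun (`[0, 1]%classic : set (measurableTypeR R)) h /\
  exists M, forall s, s \in `[0, 1] -> `|h s| <= M.

Lemma continuous_bmeas h : {within `[0, 1], continuous h} -> bmeas h.
Proof.
move=> hc; split.
  by apply: subspace_continuous_measurable_fun => //; exact: measurable_itv.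
have [M _ HM] := compact_image_bounded (@segment_compact _ 0 1) hc.
by exists M => s s01; exact: HM.
Qed.

Lemma cst_bmeas (c : R) : bmeas (fun=> c).
Proof. by apply: continuous_bmeas => ?; exact: cvg_cst. Qed.

Lemma bmeasM f g : bmeas f -> bmeas g -> bmeas (fun s => f s * g s).
Proof.
move=> [mf [M fM]] [mg [N gN]]; split; first exact: measurable_funM.
by exists (M * N) => s s01; rewrite normrM ler_pM ?fM ?gN.
Qed.

Lemma bmeas_integrable h : bmeas h -> mu.-integrable `[0, 1] (EFin \o h).
Proof.
move=> [mh [M hM]]; apply: measurable_bounded_integrable => //.
- by rewrite /= lebesgue_measure_itv/= lte_fin ltr01 oppr0 adde0 ltry.
- exists M; split; first exact: num_real.
  by move=> x Mx s/= s01; apply: le_trans (hM s s01) (ltW Mx).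
Qed.

Lemma integrable_bmeas B h : mu.-integrable `[0, 1] (EFin \o B) -> bmeas h ->
  mu.-integrable `[0, 1] (EFin \o (fun s => B s * h s)).
Proof.
move=> iB [mh [M hM]].
have -> : EFin \o (fun s => B s * h s) = ((EFin \o B) \* (EFin \o h))%E.
  by apply/funext => s /=; rewrite EFinM.
apply: integrableMl => //.
exists M; split; first exact: num_real.
by move=> x Mx s/= s01; apply: le_trans (hM s s01) (ltW Mx).
Qed.

Lemma Rintegral_oo (a b : R) f : mu.-integrable `[a, b] (EFin \o f) ->
  \int[mu]_(s in `]a, b[) f s = \int[mu]_(s in `[a, b]) f s.
Proof.
move=> fi; rewrite -Rintegral_itv_obnd_cbnd; last first.
  by apply: integrableS fi => //; exact: subset_itv_oc_cc.
rewrite -Rintegral_itv_bndo_bndc//.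
by apply: integrableS fi => //; exact: subset_itv_oo_cc.
Qed.

(** Comparison on the open interval is enough.  This matters for the weight
    b (1 - s), which is not controlled at s = 1. *)
Lemma le_Rintegral_oo (a b : R) f g : mu.-integrable `[a, b] (EFin \o f) ->
  mu.-integrable `[a, b] (EFin \o g) -> {in `]a, b[, forall s, f s <= g s} ->
  \int[mu]_(s in `[a, b]) f s <= \int[mu]_(s in `[a, b]) g s.
Proof.
move=> fi gi fg; rewrite -!Rintegral_oo//; apply: le_Rintegral => //.
- by apply: integrableS fi => //; exact: subset_itv_oo_cc.
- by apply: integrableS gi => //; exact: subset_itv_oo_cc.
Qed.

Lemma le_Rintegral_ae (a b : R) f g : mu.-integrable `[a, b] (EFin \o f) ->
  mu.-integrable `[a, b] (EFin \o g) ->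
  {in `]a, b[, forall s, 0 <= f s} -> {in `]a, b[, forall s, 0 <= g s} ->
  {ae mu, forall s, s \in `]a, b[ -> f s <= g s} ->
  \int[mu]_(s in `[a, b]) f s <= \int[mu]_(s in `[a, b]) g s.
Proof.
move=> fi gi f0 g0 fg; rewrite -!Rintegral_oo//.
have fi' : mu.-integrable `]a, b[ (EFin \o f).
  by apply: integrableS fi => //; exact: subset_itv_oo_cc.
have gi' : mu.-integrable `]a, b[ (EFin \o g).
  by apply: integrableS gi => //; exact: subset_itv_oo_cc.
apply: fine_le; [exact: integrable_fin_num|exact: integrable_fin_num|].
apply: ae_ge0_le_integral => //.
- exact: (measurable_int mu).
- exact: (measurable_int mu).
Qed.

Lemma integrable_sub01 (a b : R) f : 0 <= a -> b <= 1 ->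
  mu.-integrable `[0, 1] (EFin \o f) -> mu.-integrable `[a, b] (EFin \o f).
Proof.
move=> a0 b1; apply: integrableS => // s /=; rewrite !in_itv/= => /andP[as_ sb].
by rewrite (le_trans a0 as_) (le_trans sb b1).
Qed.

Lemma Rintegral_sub_le (a b : R) f : 0 <= a -> b <= 1 ->
  mu.-integrable `[0, 1] (EFin \o f) -> {in `]0, 1[, forall s, 0 <= f s} ->
  \int[mu]_(s in `[a, b]) f s <= \int[mu]_(s in `[0, 1]) f s.
Proof.
move=> a0 b1 fi f0.
have sub : (`]a, b[%classic : set R) `<=` `]0, 1[%classic.
  by move=> s /=; rewrite !in_itv/= => /andP[? ?]; apply/andP; split; lra.
have fi' : mu.-integrable `]0, 1[ (EFin \o f).
  by apply: integrableS fi => //; exact: subset_itv_oo_cc.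
rewrite -!Rintegral_oo//; last exact: integrable_sub01.
apply: fine_le; [|exact: integrable_fin_num|].
  by apply: integrable_fin_num => //; apply: integrableS fi'.
apply: ge0_subset_integral => //.
exact: (measurable_int mu).
Qed.

Lemma Rintegral_cst_itv (a b c : R) : a <= b ->
  \int[mu]_(s in `[a, b]) c = c * (b - a).
Proof.
move=> ab; rewrite Rintegral_cst//= lebesgue_measure_itv/= lte_fin.
case: ltrP => // ba; have -> : b = a by apply: le_anti; rewrite ab ba.
by rewrite subrr.
Qed.

Lemma continuous_integrable f : {within `[0, 1], continuous f} ->
  mu.-integrable `[0, 1] (EFin \o f).
Proof. by move/continuous_bmeas/bmeas_integrable. Qed.

Lemma integrable_cst01 (c : R) : mu.-integrable `[0, 1] (EFin \o (fun=> c)).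
Proof. exact/bmeas_integrable/cst_bmeas. Qed.

Lemma norm_Rintegral_le (f : R -> R) c : mu.-integrable `[0, 1] (EFin \o f) ->
  {in `[0, 1], forall s, `|f s| <= c} -> `|\int[mu]_(s in `[0, 1]) f s| <= c.
Proof.
move=> fi fc; apply: le_trans (le_normr_Rintegral _ _) _ => //.
rewrite -[leRHS]mulr1 -[X in _ * X]subr0 -Rintegral_cst_itv//.
apply: le_Rintegral => //; [exact: integrable_norm|exact: integrable_cst01].
Qed.

Lemma integrable_sub_fun (f g : R -> R) : mu.-integrable `[0, 1] (EFin \o f) ->
  mu.-integrable `[0, 1] (EFin \o g) ->
  mu.-integrable `[0, 1] (EFin \o (fun s => f s - g s)).
Proof.
move=> fi gi; rewrite (_ : _ \o _ = ((EFin \o f) \- (EFin \o g))%E).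
  exact: integrableB.
by apply/funext => t /=; rewrite EFinB.
Qed.

Lemma Rintegral_sum n (F : 'I_n -> R -> R) :
  (forall i, mu.-integrable `[0, 1] (EFin \o F i)) ->
  mu.-integrable `[0, 1] (EFin \o (fun s => \sum_i F i s)) /\
  \int[mu]_(s in `[0, 1]) (\sum_i F i s) = \sum_i \int[mu]_(s in `[0, 1]) F i s.
Proof.
move=> Fi; elim: n F Fi => [|n IH] F Fi.
  rewrite big_ord0; split.
    rewrite (_ : _ \o _ = cst 0%E); first exact: integrable0.
    by apply/funext => s /=; rewrite big_ord0.
  by under eq_Rintegral do rewrite big_ord0; rewrite Rintegral_cst// mul0r.
have [i1 i2] := IH (fun i => F (lift ord0 i)) (fun i => Fi _).
split.
  rewrite (_ : _ \o _ = ((EFin \o F ord0) \+ (EFin \o (fun s : R => \sum_i F (lift ord0 i) s)%R))%E).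
    exact: integrableD.
  by apply/funext => s /=; rewrite big_ord_recl EFinD.
under eq_Rintegral do rewrite big_ord_recl.
by rewrite RintegralD// i2 big_ord_recl.
Qed.

(** One quadrature rule that is valid for all functions with a given modulus of
    continuity at scale d.  It lets integrals in t be exchanged with integrals
    in s by linearity of finite sums, with no joint measurability. *)
Lemma quadrature (d : R) : 0 < d ->
  exists n (s : 'I_n -> R) (W : 'I_n -> R), [/\ forall i, s i \in `[0, 1],
    forall i, 0 <= W i &
    forall (phi : R -> R) (e : R), {within `[0, 1], continuous phi} ->
      (forall x y, x \in `[0, 1] -> y \in `[0, 1] -> `|x - y| < d ->
         `|phi x - phi y| <= e) ->
      `|\sum_i phi (s i) * W i - \int[mu]_(t in `[0, 1]) phi t| <= e].
Proof.
move=> d0; have [s [s01 snet]] := unit_net d0.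
pose n := size s; pose nd (i : 'I_n) := nth 0 s i.
have nd01 i : nd i \in `[0, 1] by apply: s01; exact: mem_nth.
have ndd t : t \in `[0, 1] -> exists i, `|t - nd i| < d.
  move=> /snet[x xs tx]; have xn : (index x s < n)%N by rewrite index_mem.
  by exists (Ordinal xn); rewrite /nd/= nth_index.
pose w i := interp nd d (fun j => (j == i)%:R).
have wN i : nncont (w i) by apply: interp_nncont.
have interpE x t : interp nd d x t = \sum_i x i * w i t.
  rewrite /interp mulr_suml; apply: eq_bigr => i _.
  rewrite /w /interp mulrA; congr (_ * _ / _).
  rewrite (bigD1 i)//= eqxx mul1r big1 ?addr0// => j /negPf ->.
  by rewrite mul0r.
exists n, nd, (fun i => \int[mu]_(t in `[0, 1]) w i t); split => // [i|phi e pc Hphi].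
  by apply: Rintegral_ge0 => t t01; case: (wN i) => _; apply.
have iw i : mu.-integrable `[0, 1] (EFin \o w i).
  by apply: continuous_integrable; case: (wN i).
have iphi := continuous_integrable pc.
have iwz i : mu.-integrable `[0, 1] (EFin \o (fun t => phi (nd i) * w i t)).
  by apply: integrable_bmeas; [exact/bmeas_integrable/cst_bmeas|apply: continuous_bmeas; case: (wN i)].
have [iS eS] := Rintegral_sum iwz.
have -> : \sum_i phi (nd i) * \int[mu]_(t in `[0, 1]) w i t =
    \int[mu]_(t in `[0, 1]) (\sum_i phi (nd i) * w i t).
  by rewrite eS; apply: eq_bigr => i _; rewrite RintegralZl.
rewrite -RintegralB//.
apply: norm_Rintegral_le; first exact: integrable_sub_fun.
move=> t t01; rewrite -interpE; apply: interp_near => // i ti.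
by apply: Hphi => //; rewrite distrC.
Qed.

End Integration.

(** * Inequalities for real powers *)
Section PowerBounds.
Variable R : realType.
Implicit Types x N p pm pp q : R.

Lemma powR_le_max pm pp p x N : 0 < pm -> pm <= p <= pp -> 0 <= x <= N ->
  x `^ p <= Num.max (N `^ pp) (N `^ pm).
Proof.
move=> pm0 /andP[pmp ppp] /andP[x0 xN].
have p0 : 0 < p by apply: lt_le_trans pmp.
have N0 : 0 <= N by apply: le_trans xN.
apply: (@le_trans _ _ (N `^ p)).
  by apply: ge0_ler_powR; rewrite ?nnegrE// ltW.
rewrite le_max; have [N1|N1] := leP 1 N.
  by rewrite (ler_powR N1 ppp).
move: N0; rewrite le_eqVlt => /predU1P[<-|N0].
  by rewrite powR0 ?powR_ge0// gt_eqF.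
by rewrite (ger_powR _ pmp) ?orbT// N0 ltW.
Qed.

Lemma powR_ge_minus1 pm p x : 0 <= pm -> pm <= p -> 0 <= x -> x `^ pm - 1 <= x `^ p.
Proof.
move=> pm0 pmp x0; have [x1|x1] := leP 1 x.
  by apply: le_trans (ler_powR x1 pmp); rewrite gerBl.
apply: (@le_trans _ _ 0); last exact: powR_ge0.
rewrite subr_le0; have -> : (1 : R) = 1 `^ pm by rewrite powR1.
by apply: ge0_ler_powR; rewrite ?nnegrE// ltW.
Qed.

(** If X < 1 the left-hand side is nonpositive; otherwise
    x ^ p >= eta ^ p * N ^ p >= eta ^ pp * X ^ pm. *)
Lemma powR_ge_scaled pm pp p eta X N x : 0 < pm -> pm <= p <= pp ->
  0 < eta <= 1 -> 0 <= X <= N -> eta * N <= x ->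
  eta `^ pp * (X `^ pm - 1) <= x `^ p.
Proof.
move=> pm0 /andP[pmp ppp] /andP[e0 e1] /andP[X0 XN] Nx.
have p0 : 0 < p by apply: lt_le_trans pmp.
have N0 : 0 <= N by apply: le_trans XN.
have [X1|X1] := leP 1 X; last first.
  apply: (@le_trans _ _ 0); last exact: powR_ge0.
  rewrite pmulr_rle0 ?powR_gt0// subr_le0.
  have -> : (1 : R) = 1 `^ pm by rewrite powR1.
  by apply: ge0_ler_powR; rewrite ?nnegrE// ltW.
apply: (@le_trans _ _ ((eta * N) `^ p)); last first.
  apply: ge0_ler_powR => //; rewrite ?nnegrE ?(ltW p0)//.
    by rewrite mulr_ge0// ltW.
  by apply: le_trans Nx; rewrite mulr_ge0// ltW.
rewrite powRM// ?(ltW e0)//; apply: ler_pM.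
- exact: powR_ge0.
- rewrite subr_ge0; have -> : (1 : R) = 1 `^ pm by rewrite powR1.
  by apply: ge0_ler_powR; rewrite ?nnegrE// ltW.
- by apply: ger_powR => //; rewrite e0.
- apply: (@le_trans _ _ (X `^ p)).
    by apply: powR_ge_minus1 => //; exact: ltW.
  by apply: ge0_ler_powR; rewrite ?nnegrE// ltW.
Qed.

(** Young's inequality with exponents q and q / (q - 1) for the factors
    x * (B / rho) ^ (1/q) and B ^ (- 1/q) * Q ^ (- (q - 1)/q).  They are scaled
    so that integration gives a Hoelder inequality when rho bounds the integral
    of B x ^ q and Q bounds that of B ^ (1 / (1 - q)). *)
Lemma young_weighted q rho Q B x : 1 < q -> 0 < rho -> 0 < Q -> 0 < B -> 0 <= x ->
  x <= rho `^ q^-1 * Q `^ ((q - 1) / q) *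
    (B * x `^ q / (rho * q) + B `^ (1 - q)^-1 / Q * ((q - 1) / q)).
Proof.
move=> q1 rho0 Q0 B0 x0.
have q0 : 0 < q by apply: lt_trans q1.
have qn0 : q != 0 by rewrite gt_eqF.
have qm0 : 0 < q - 1 by rewrite subr_gt0.
have qmn0 : q - 1 != 0 by rewrite gt_eqF.
pose q' := q / (q - 1).
have q'0 : 0 < q' by rewrite divr_gt0.
have conj : q^-1 + q'^-1 = 1 by rewrite /q' invf_div -[X in X + _]mul1r -mulrDl addrC subrK divff.
pose H := rho `^ q^-1 * Q `^ ((q - 1) / q).
have H0 : 0 < H by rewrite mulr_gt0// powR_gt0.
pose a := x * (B / rho) `^ q^-1.
pose c := (B `^ (- q^-1)) * Q `^ (- q'^-1).
have a0 : 0 <= a by rewrite mulr_ge0// powR_ge0.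
have c0 : 0 <= c by rewrite mulr_ge0// powR_ge0.
have := conjugate_powR a0 c0 q0 q'0 conj.
have -> : a * c = x / H.
  have -> : a = x * (B `^ q^-1 / rho `^ q^-1).
    rewrite /a powRM ?invr_ge0 ?(ltW B0) ?(ltW rho0)//.
    by rewrite -(powR_inv1 (ltW rho0)) -powRrM mulN1r powRN.
  rewrite /c /H !powRN /q' invf_div.
  have : B `^ q^-1 != 0 by rewrite gt_eqF ?powR_gt0.
  have : rho `^ q^-1 != 0 by rewrite gt_eqF ?powR_gt0.
  have : Q `^ ((q - 1) / q) != 0 by rewrite gt_eqF ?powR_gt0.
  move: (_ `^ _) (_ `^ _) (_ `^ _) => u v w u0 v0 w0.
  by field; rewrite u0 v0 w0.
rewrite ler_pdivrMr// => /le_trans; apply; rewrite mulrC ler_pM2l//.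
have -> : a `^ q = x `^ q * (B / rho).
  by rewrite /a powRM ?powR_ge0// -powRrM mulVf// powRr1// divr_ge0 ?ltW.
have -> : c `^ q' = B `^ (1 - q)^-1 / Q.
  rewrite /c powRM ?powR_ge0// -!powRrM; congr (_ `^ _ * _).
    by rewrite /q' mulNr mulrA mulVf// mul1r -invrN opprB.
  by rewrite mulNr mulVf ?gt_eqF// powR_inv1// ltW.
rewrite le_eqVlt; apply/orP; left; apply/eqP.
rewrite /q' invf_div; congr (_ + _).
by field; rewrite qn0 gt_eqF.
Qed.

End PowerBounds.

(** * Superposition operators *)
Section Superposition.
Variable R : realType.
Implicit Types (u v p : R -> R) (h : R -> R -> R).

Lemma within_continuous_id : {within `[0, 1], continuous (@id R)}.
Proof. by apply: continuous_subspaceT => x; exact: cvg_id. Qed.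

Lemma nncont_bound u : nncont u ->
  exists2 M, 0 < M & {in `[0, 1], forall t, 0 <= u t <= M}.
Proof.
move=> [uc u0]; have [M M0 HM] := compact_image_bounded (@segment_compact _ 0 1) uc.
exists (M + 1); first by rewrite ltr_wpDl.
move=> t t01; rewrite u0//=; apply: le_trans (ler_norm _) _.
by apply: le_trans (HM t t01) _; rewrite lerDl.
Qed.

Lemma powp_nncont pm pp p u : 0 < pm ->
  {within `[0, 1], continuous p} -> {in `[0, 1], forall t, pm <= p t <= pp} ->
  nncont u -> nncont (fun s => u s `^ p s).
Proof.
move=> pm0 pc pb [uc u0]; split; last by move=> t _; exact: powR_ge0.
have := @within_continuous_pair R (fun r x : R => x `^ r) _ p u
  (@continuous_powR2 R pm pp pm0) pc uc; apply => s s01.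
by split => /=; rewrite in_itv/= ?andbT; [exact: pb|exact: u0].
Qed.

(** The values of v and u at distance at most 1 from each other stay in a fixed
    compact rectangle, on which h is uniformly continuous. *)
Lemma superposition_cont (a b : R) h p u (e : R) :
  {within `[a, b] `*` `[0, +oo[, continuous (uncurry h)} ->
  {in `[0, 1], forall t, a <= p t <= b} -> nncont u -> 0 < e ->
  exists2 d, 0 < d & forall v, nncont v ->
    (forall t, t \in `[0, 1] -> `|v t - u t| <= d) ->
    forall t, t \in `[0, 1] -> `|h (p t) (v t) - h (p t) (u t)| <= e.
Proof.
move=> hc pb uN e0; have [M M0 uM] := nncont_bound uN.
have cK : compact (`[a, b] `*` `[0, M + 1] : set (R * R)).
  by apply: compact_setX; exact: segment_compact.
have hc' : {within `[a, b] `*` `[0, M + 1], continuous (uncurry h)}.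
  apply: continuous_subspaceW hc => -[x y] /= [xab]; rewrite !in_itv/= andbT.
  by move=> /andP[].
have [d d0 Hd] := heine cK hc' e0.
exists (Num.min 1 (d / 2)); first by rewrite lt_min ltr01 divr_gt0.
move=> v [vc v0] vu t t01; apply: ltW; have := vu t t01.
rewrite le_min => /andP[vu1 vud]; have /andP[ut0 utM] := uM t t01.
have pab : (`[a, b]%classic : set R) (p t) by rewrite /= in_itv/=; exact: pb.
apply: Hd.
- split => //=; rewrite in_itv/= v0//=.
  by rewrite -lerBlDl; apply: le_trans vu1; apply: le_trans (ler_norm _); rewrite lerB.
- by split => //=; rewrite in_itv/= ut0/= (le_trans utM)// lerDl.
- by rewrite subrr normr0.
- by apply: le_lt_trans vud _; rewrite ltr_pdivrMr// ltr_pMr// ltr1n.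
Qed.

End Superposition.

(** * The nonlocal functional *)
Section Nonlocal.
Variables (R : realType) (b p : R -> R) (pm pp : R).
Notation mu := (@lebesgue_measure R).
Hypothesis b_ge0 : {in `]0, 1], forall t, 0 <= b t}.
Hypothesis b_L1 : mu.-integrable `]0, 1] (EFin \o b).
Hypothesis pm_gt0 : 0 < pm.
Hypothesis p_cont : {within `[0, 1], continuous p}.
Hypothesis p_bnd : {in `[0, 1], forall t, pm <= p t <= pp}.
Implicit Types u v : R -> R.

Let B s := b (1 - s).
Let mass := fconv b (fun=> 1) 1.

Lemma weight_integrable : mu.-integrable `[0, 1] (EFin \o B).
Proof. exact: integrable_reflect. Qed.

Lemma weight_ge0 : {in `]0, 1[, forall s, 0 <= B s}.
Proof.
move=> s; rewrite in_itv/= => /andP[? ?]; apply: b_ge0.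
by rewrite in_itv/=; apply/andP; split; lra.
Qed.

Lemma massE : mass = \int[mu]_(s in `[0, 1]) B s.
Proof. by rewrite /mass /fconv; apply: eq_Rintegral => s _; rewrite mulr1. Qed.

Lemma mass_ge0 : 0 <= mass.
Proof.
rewrite massE -Rintegral_oo; last exact: weight_integrable.
by apply: Rintegral_ge0 => s s01; exact: weight_ge0.
Qed.

Lemma powp_bmeas u : nncont u -> bmeas (fun s => u s `^ p s).
Proof. by move=> uN; apply: continuous_bmeas; have [] := powp_nncont pm_gt0 p_cont p_bnd uN. Qed.

Lemma nonlocal_int u : nncont u ->
  mu.-integrable `[0, 1] (EFin \o (fun s => B s * u s `^ p s)).
Proof. by move=> uN; apply: integrable_bmeas; [exact: weight_integrable|exact: powp_bmeas]. Qed.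

Lemma nonlocal_cont u e : nncont u -> 0 < e -> exists2 d, 0 < d &
  forall v, nncont v -> (forall t, t \in `[0, 1] -> `|v t - u t| <= d) ->
    `|nonlocal b p v - nonlocal b p u| <= e.
Proof.
move=> uN e0; pose e' := e / (mass + 1).
have m1 : 0 < mass + 1 by rewrite ltr_wpDl ?mass_ge0.
have e'0 : 0 < e' by rewrite divr_gt0.
have [d d0 Hd] := superposition_cont (@continuous_powR2 R pm pp pm_gt0) p_bnd uN e'0.
exists d => // v vN vu; have {}Hd := Hd v vN vu.
have iv := nonlocal_int vN; have iu := nonlocal_int uN.
rewrite /nonlocal /fconv -RintegralB//.
have iB := integrable_sub_fun iv iu.
apply: le_trans (le_normr_Rintegral _ _) _ => //.
apply: (@le_trans _ _ (mass * e')); last first.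
  by rewrite /e' mulrCA ger_pMr// ler_pdivrMr// mul1r lerDl.
rewrite massE -RintegralZr//; last exact: weight_integrable.
apply: le_Rintegral_oo.
- exact: integrable_norm.
- by apply: integrable_bmeas; [exact: weight_integrable|exact: cst_bmeas].
- move=> s s01; rewrite -/(B s) -mulrBr normrM (ger0_norm (weight_ge0 s01)).
  rewrite ler_wpM2l ?weight_ge0// Hd//.
  exact: subset_itv_oo_cc s01.
Qed.

Lemma nonlocal_le u N : nncont u -> {in `[0, 1], forall t, u t <= N} ->
  nonlocal b p u <= Num.max (N `^ pp) (N `^ pm) * mass.
Proof.
move=> uN uleN; rewrite mulrC massE -RintegralZr//; last exact: weight_integrable.
apply: le_Rintegral_oo; first exact: nonlocal_int.
  by apply: integrable_bmeas; [exact: weight_integrable|exact: cst_bmeas].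
move=> s s01; have s01' := subset_itv_oo_cc s01.
rewrite ler_wpM2l ?weight_ge0// powR_le_max ?p_bnd// uleN// andbT.
by case: uN => _; apply.
Qed.

Lemma nonlocal_ge u alpha beta eta X N : nncont u ->
  0 <= alpha -> beta <= 1 -> 0 < eta <= 1 -> 0 <= X <= N ->
  {in `[alpha, beta], forall t, eta * N <= u t} ->
  eta `^ pp * (X `^ pm - 1) * \int[mu]_(s in `[alpha, beta]) b (1 - s) <= nonlocal b p u.
Proof.
move=> uN a0 b1 eta01 XN uge.
have sub s : s \in `[alpha, beta] -> s \in `[0, 1].
  by rewrite !in_itv/= => /andP[? ?]; apply/andP; split; lra.
have subo s : s \in `]alpha, beta[ -> s \in `]0, 1[.
  by rewrite !in_itv/= => /andP[? ?]; apply/andP; split; lra.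
have iab f := @integrable_sub01 R alpha beta f a0 b1.
have iu := nonlocal_int uN.
apply: (@le_trans _ _ (\int[mu]_(s in `[alpha, beta]) (B s * u s `^ p s))); last first.
  apply: Rintegral_sub_le => // s s01; rewrite mulr_ge0 ?weight_ge0 ?powR_ge0//.
rewrite mulrC -RintegralZr//; last by apply: iab; exact: weight_integrable.
apply: le_Rintegral_oo.
- by apply: iab; apply: integrable_bmeas; [exact: weight_integrable|exact: cst_bmeas].
- exact: iab.
- move=> s sab; rewrite ler_wpM2l ?weight_ge0 ?subo//.
  have sab' := subset_itv_oo_cc sab.
  by apply: powR_ge_scaled XN (uge s sab') => //; exact/p_bnd/sub.
Qed.

Section ReverseHoelder.
Variable q : R.
Hypothesis q_gt1 : 1 < q.
Hypothesis b_gt0 : {ae mu, forall t, t \in `]0, 1] -> 0 < b t}.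
Hypothesis bq_L1 : mu.-integrable `]0, 1] (EFin \o (fun s => b s `^ (1 - q)^-1)).

Let Bq s := B s `^ (1 - q)^-1.
Let Q := fconv (fun s => b s `^ (1 - q)^-1) (fun=> 1) 1.

Let Bq_int : mu.-integrable `[0, 1] (EFin \o Bq).
Proof. exact: (integrable_reflect bq_L1). Qed.

Let QE : Q = \int[mu]_(s in `[0, 1]) Bq s.
Proof. by rewrite /Q /fconv; apply: eq_Rintegral => s _; rewrite mulr1. Qed.

(** Integrate [young_weighted]; it holds where the weight is positive, that is,
    almost everywhere. *)
Lemma hoelder_weighted w rho Q' : nncont w -> 0 < rho -> 0 < Q' -> Q <= Q' ->
  \int[mu]_(s in `[0, 1]) (B s * w s `^ q) <= rho ->
  \int[mu]_(s in `[0, 1]) w s <= rho `^ q^-1 * Q' `^ ((q - 1) / q).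
Proof.
move=> wN rho0 Q'0 QQ' intle.
have q0 : 0 < q by apply: lt_trans q_gt1.
have qm0 : 0 < q - 1 by rewrite subr_gt0.
pose H := rho `^ q^-1 * Q' `^ ((q - 1) / q).
have H0 : 0 < H by rewrite mulr_gt0// powR_gt0.
have wq : bmeas (fun s => w s `^ q).
  apply: continuous_bmeas.
  have [] := @powp_nncont R q q (fun=> q) w q0 _ _ wN => //.
    by move=> ?; exact: cvg_cst.
  by move=> t _; rewrite lexx.
have i1 : mu.-integrable `[0, 1] (EFin \o (fun s => B s * w s `^ q)).
  by apply: integrable_bmeas; [exact: weight_integrable|].
have i1' : mu.-integrable `[0, 1] (EFin \o (fun s => (B s * w s `^ q) * (H / (rho * q)))).
  by apply: integrable_bmeas => //; exact: cst_bmeas.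
have i2 : mu.-integrable `[0, 1] (EFin \o (fun s => Bq s * (H / Q' * ((q - 1) / q)))).
  by apply: integrable_bmeas => //; exact: cst_bmeas.
have iS : mu.-integrable `[0, 1] (EFin \o (fun s =>
    (B s * w s `^ q) * (H / (rho * q)) + Bq s * (H / Q' * ((q - 1) / q)))).
  rewrite (_ : _ \o _ = ((EFin \o (fun s => (B s * w s `^ q) * (H / (rho * q)))%R) \+
     (EFin \o (fun s => Bq s * (H / Q' * ((q - 1) / q)))%R))%E).
    exact: integrableD.
  by apply/funext => t /=; rewrite EFinD.
apply: (@le_trans _ _ (\int[mu]_(s in `[0, 1])
    ((B s * w s `^ q) * (H / (rho * q)) + Bq s * (H / Q' * ((q - 1) / q))))).
  apply: le_Rintegral_ae => //.
  - by apply: continuous_integrable; case: wN.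
  - by move=> s s01; case: wN => _; apply; exact: subset_itv_oo_cc s01.
  - move=> s s01; rewrite addr_ge0// mulr_ge0//; rewrite ?mulr_ge0 ?weight_ge0 ?powR_ge0//.
    + by rewrite invr_ge0 mulr_ge0 ?ltW.
    + by rewrite invr_ge0 ltW.
    + by rewrite ltW.
    + by rewrite invr_ge0 ltW.
  - have [N [mN N0 sub]] := ae_reflect b_gt0; exists N; split => // s /= ns.
    apply: sub => /= Hs; apply: ns => s01.
    have Bs : 0 < B s.
      by apply: Hs; rewrite in_itv/=; move: s01; rewrite in_itv/= => /andP[/ltW-> ->].
    have ws : 0 <= w s by case: wN => _; apply; exact: subset_itv_oo_cc s01.
    apply: le_trans (young_weighted q_gt1 rho0 Q'0 Bs ws) _.
    rewrite -/H /Bq le_eqVlt; apply/orP; left; apply/eqP.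
    by ring.
rewrite RintegralD// !RintegralZr// -QE.
apply: (@le_trans _ _ (rho * (H / (rho * q)) + Q' * (H / Q' * ((q - 1) / q)))).
  apply: lerD; rewrite ler_wpM2r//.
    by apply/ltW/divr_gt0 => //; exact: mulr_gt0.
  by apply/ltW/mulr_gt0; exact: divr_gt0.
rewrite -/H le_eqVlt; apply/orP; left; apply/eqP.
by field; rewrite !gt_eqF.
Qed.

(** If Q vanished, [hoelder_weighted] for the constant function 1 would hold
    with every Q' > 0, which is absurd for a small Q'. *)
Lemma dual_mass_gt0 : 0 < Q.
Proof.
have q0 : 0 < q by apply: lt_trans q_gt1.
have qm0 : 0 < q - 1 by rewrite subr_gt0.
have Q0 : 0 <= Q.
  by rewrite QE; apply: Rintegral_ge0 => s _; exact: powR_ge0.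
rewrite lt_neqAle Q0 andbT; apply/eqP => Q0'.
pose r := mass + 1.
have r0 : 0 < r by rewrite ltr_wpDl ?mass_ge0.
have one : nncont (fun=> 1 : R).
  by split => [|t _]; [move=> ?; exact: cvg_cst|exact: ler01].
(* Chosen so that the bound r ^ (1/q) * Q' ^ ((q - 1)/q) equals 1/2. *)
pose Q' := (2 * r `^ q^-1) `^ (- (q / (q - 1))).
have r'0 : 0 < r `^ q^-1 by rewrite powR_gt0.
have Q'0 : 0 < Q' by rewrite powR_gt0// mulr_gt0.
have := @hoelder_weighted (fun=> 1) r Q' one r0 Q'0.
rewrite -Q0' ltW// => /(_ isT); rewrite powR1.
have -> : \int[mu]_(s in `[0, 1]) (B s * 1) = mass by [].
rewrite lerDl ler01 => /(_ isT).
rewrite Rintegral_cst_itv// subr0 mulr1 /Q' -powRrM.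
have -> : - (q / (q - 1)) * ((q - 1) / q) = -1.
  by rewrite mulNr mulrA mulfVK ?divff// gt_eqF.
rewrite powR_inv1; last by rewrite mulr_ge0// ltW.
by rewrite invfM mulrC mulfVK ?gt_eqF// leNgt invf_lt1// ltr1n.
Qed.

(** Reverse Hoelder inequality: the integral of u ^ (p/q) is at most
    H = rho ^ (1/q) * Q ^ ((q - 1)/q), and it is at least
    (Y ^ (pm/q) - 1) * (beta - alpha) since u >= Y on [alpha, beta].  As
    beta - alpha <= 1, this gives (beta - alpha) * Y ^ (pm/q) <= H + 1. *)
Lemma le_dual_bound u alpha beta Y rho : nncont u ->
  0 <= alpha -> alpha < beta -> beta <= 1 -> 0 < rho -> 0 <= Y ->
  {in `[alpha, beta], forall t, Y <= u t} -> nonlocal b p u <= rho ->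
  Y <= (beta - alpha) `^ (- (q / pm)) *
       (rho `^ q^-1 * Q `^ ((q - 1) / q) + 1) `^ (q / pm).
Proof.
move=> uN a0 ab b1 rho0 Y0 uY philerho.
have q0 : 0 < q by apply: lt_trans q_gt1.
have qn0 : q != 0 by rewrite gt_eqF.
have ba0 : 0 < beta - alpha by rewrite subr_gt0.
pose H := rho `^ q^-1 * Q `^ ((q - 1) / q).
have H0 : 0 <= H by rewrite mulr_ge0// powR_ge0.
pose w s := u s `^ (p s / q).
have pq0 : 0 < pm / q by rewrite divr_gt0.
have wN : nncont w.
  apply: (@powp_nncont R (pm / q) (pp / q) (fun s => p s / q) u pq0) => //.
    by move=> s; apply: cvgM; [exact: p_cont|exact: cvg_cst].
  by move=> t /p_bnd /andP[? ?]; rewrite !ler_pM2r ?invr_gt0//; apply/andP.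
have intw : \int[mu]_(s in `[0, 1]) w s <= H.
  have intE : \int[mu]_(s in `[0, 1]) (B s * w s `^ q) = nonlocal b p u.
    by apply: eq_Rintegral => s _; rewrite /w -powRrM divfK.
  by apply: (hoelder_weighted wN rho0 dual_mass_gt0 (lexx _)); rewrite intE.
have iw : mu.-integrable `[0, 1] (EFin \o w).
  by apply: continuous_integrable; case: wN.
have sub s : s \in `[alpha, beta] -> s \in `[0, 1].
  by rewrite !in_itv/= => /andP[? ?]; apply/andP; split; lra.
have main : (Y `^ (pm / q) - 1) * (beta - alpha) <= H.
  apply: le_trans intw.
  apply: (@le_trans _ _ (\int[mu]_(s in `[alpha, beta]) w s)); last first.
    by apply: Rintegral_sub_le => // s s01; exact: powR_ge0.
  rewrite -Rintegral_cst_itv ?(ltW ab)//; apply: le_Rintegral => //.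
  - apply: integrable_sub01 => //.
    by apply: bmeas_integrable; exact: cst_bmeas.
  - exact: integrable_sub01.
  move=> s sab; have /andP[pms psp] := p_bnd (sub s sab).
  have pqs : pm / q <= p s / q by rewrite ler_pM2r ?invr_gt0.
  apply: le_trans (powR_ge_minus1 (ltW pq0) pqs Y0) _.
  have pq0' : 0 <= p s / q by apply: le_trans pqs; exact: ltW.
  apply: ge0_ler_powR; rewrite ?nnegrE//.
  - by case: uN => _; apply; exact: sub.
  - exact: uY.
have Yle : Y `^ (pm / q) <= (beta - alpha)^-1 * (H + 1).
  rewrite ler_pdivlMl// mulrC -[_ * _](subrK ((beta - alpha))).
  rewrite -[X in _ - X]mul1r -mulrBl lerD//; lra.
have -> : Y = (Y `^ (pm / q)) `^ (q / pm).
  by rewrite -powRrM mulrA divfK// divff ?gt_eqF// powRr1.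
have -> : (beta - alpha) `^ (- (q / pm)) = (beta - alpha)^-1 `^ (q / pm).
  by rewrite -(powR_inv1 (ltW ba0)) -powRrM mulN1r.
rewrite -powRM ?invr_ge0 ?(ltW ba0) ?addr_ge0//.
apply: ge0_ler_powR; rewrite ?nnegrE ?powR_ge0//.
  by rewrite divr_ge0// ltW.
by rewrite mulr_ge0 ?invr_ge0 ?(ltW ba0) ?addr_ge0.
Qed.

End ReverseHoelder.
End Nonlocal.

(** * The Green operator *)
Section GreenOperator.
Variables (R : realType) (G : R -> R -> R) (alpha beta eta0 : R).
Notation mu := (@lebesgue_measure R).
Hypothesis G_cont : {within `[0, 1] `*` `[0, 1], continuous (uncurry G)}.
Hypothesis G_ge0 : forall t s, t \in `[0, 1] -> s \in `[0, 1] -> 0 <= G t s.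
Hypothesis green_sup_gt0 : {in `]0, 1[, forall s, 0 < green_sup G s}.
Hypothesis alpha_ge0 : 0 <= alpha.
Hypothesis alpha_beta : alpha < beta.
Hypothesis beta_le1 : beta <= 1.
Hypothesis eta0_gt0 : 0 < eta0.
Hypothesis G_harnack : {in `[0, 1], forall s,
  min_on `[alpha, beta] (fun t => G t s) >= eta0 * green_sup G s}.

Definition green_op (h : R -> R) (t : R) : R :=
  \int[mu]_(s in `[0, 1]) (G t s * h s).

Let square_compact : compact (`[0, 1] `*` `[0, 1] : set (R * R)).
Proof. by apply: compact_setX; exact: segment_compact. Qed.

Lemma green_bounded : exists2 M, 0 <= M &
  forall t s, t \in `[0, 1] -> s \in `[0, 1] -> G t s <= M.
Proof.
have [M M0 HM] := compact_image_bounded square_compact G_cont.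
by exists M => // t s t01 s01; apply: le_trans (ler_norm _) (HM (t, s) _).
Qed.

Lemma green_equi (e : R) : 0 < e -> exists2 d, 0 < d & forall t t' s,
  t \in `[0, 1] -> t' \in `[0, 1] -> s \in `[0, 1] -> `|t - t'| < d ->
  `|G t s - G t' s| < e.
Proof.
move=> e0; have [d d0 Hd] := heine square_compact G_cont e0.
by exists d => // t t' s t01 t'01 s01 tt'; apply: Hd => //; rewrite subrr normr0.
Qed.

Lemma green_cont_r t : t \in `[0, 1] -> {within `[0, 1], continuous (G t)}.
Proof.
move=> t01; have := @within_continuous_pair R G _ (fun=> t) id G_cont _ (@within_continuous_id R).
by apply => [x|s s01]; [exact: cvg_cst|split].
Qed.

Lemma green_cont_l s : s \in `[0, 1] -> {within `[0, 1], continuous (fun t => G t s)}.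
Proof.
move=> s01; have := @within_continuous_pair R G _ id (fun=> s) G_cont (@within_continuous_id R) _.
by apply => [x|t t01]; [exact: cvg_cst|split].
Qed.

Lemma green_int h t : bmeas h -> t \in `[0, 1] ->
  mu.-integrable `[0, 1] (EFin \o (fun s => G t s * h s)).
Proof.
move=> hm t01; apply: bmeas_integrable; apply: bmeasM => //.
exact/continuous_bmeas/green_cont_r.
Qed.

Lemma green_op_ge0 h (t : R) : {in `[0, 1], forall s, 0 <= h s} -> t \in `[0, 1] ->
  0 <= green_op h t.
Proof.
move=> h0 t01; apply: Rintegral_ge0 => s s01.
by rewrite mulr_ge0 ?h0 ?G_ge0.
Qed.

(** Stated with two densities and two points to cover both the equicontinuity
    of the images and the continuity of the operator. *)
Lemma green_op_dist h h' t t' c : bmeas h -> bmeas h' ->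
  t \in `[0, 1] -> t' \in `[0, 1] ->
  {in `[0, 1], forall s, `|G t s * h s - G t' s * h' s| <= c} ->
  `|green_op h t - green_op h' t'| <= c.
Proof.
move=> hm h'm t01 t'01 Hc; have i1 := green_int hm t01; have i2 := green_int h'm t'01.
rewrite /green_op -RintegralB//; apply: norm_Rintegral_le => //.
exact: integrable_sub_fun.
Qed.

Lemma green_op_equi H e : 0 <= H -> 0 < e -> exists2 d, 0 < d & forall h, bmeas h ->
  {in `[0, 1], forall s, `|h s| <= H} -> forall t t', t \in `[0, 1] -> t' \in `[0, 1] ->
  `|t - t'| < d -> `|green_op h t - green_op h t'| <= e.
Proof.
move=> H0 e0; have H1 : 0 < H + 1 by rewrite ltr_wpDl.
have e'0 : 0 < e / (H + 1) by rewrite divr_gt0.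
have [d d0 Hd] := green_equi e'0.
exists d => // h hm hH t t' t01 t'01 tt'; apply: green_op_dist => // s s01.
rewrite -mulrBl normrM; apply: (@le_trans _ _ (e / (H + 1) * (H + 1))).
  apply: ler_pM => //; first exact/ltW/Hd.
  by apply: le_trans (hH s s01) _; rewrite lerDl.
by rewrite divfK// gt_eqF.
Qed.

Lemma green_op_cont h : bmeas h -> {within `[0, 1], continuous (green_op h)}.
Proof.
move=> hm; have [_ [M hM]] := hm.
have hM' : {in `[0, 1], forall s, `|h s| <= `|M|}.
  by move=> s s01; apply: le_trans (hM s s01) (ler_norm _).
apply/subspace_continuousP => t t01; apply/cvgrPdist_le => e e0.
have [d d0 Hd] := green_op_equi (normr_ge0 M) e0.
rewrite near_withinE; near=> s => s01.
by apply: (Hd h) => //; near: s; exact: nbhsx_ballx.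
Unshelve. all: by end_near. Qed.

Lemma le_max_norm (u : R -> R) t : {within `[0, 1], continuous u} -> t \in `[0, 1] ->
  `|u t| <= max_norm u.
Proof.
move=> uc t01; have [M _ HM] := compact_image_bounded (@segment_compact _ 0 1) uc.
exact: (le_max_on (D := `[0, 1]%classic) HM).
Qed.

Lemma max_norm_le (u : R -> R) c : {in `[0, 1], forall t, `|u t| <= c} -> max_norm u <= c.
Proof.
move=> uc; apply: (@max_on_le _ _ _ _ _ 0); last exact: uc.
by rewrite /= in_itv/= lexx ler01.
Qed.

Lemma green_le_sup t s : t \in `[0, 1] -> s \in `[0, 1] -> G t s <= green_sup G s.
Proof.
move=> t01 s01; have [M _ HM] := green_bounded.
by apply: (le_max_on (D := `[0, 1]%classic) (M := M)) => // y y01; exact: HM.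
Qed.

Let sub_ab (t : R) : t \in `[alpha, beta] -> t \in `[0, 1].
Proof.
rewrite !in_itv/= => /andP[H1 H2].
by rewrite (le_trans alpha_ge0 H1) (le_trans H2 beta_le1).
Qed.

Lemma green_le_harnack tau t s : tau \in `[0, 1] -> t \in `[alpha, beta] ->
  s \in `[0, 1] -> eta0 * G tau s <= G t s.
Proof.
move=> tau01 tab s01; apply: (@le_trans _ _ (eta0 * green_sup G s)).
  by rewrite ler_pM2l// green_le_sup.
apply: le_trans (G_harnack s01) _.
apply: (@min_on_le _ _ `[alpha, beta]%classic (fun t => G t s) 0) => // y yab.
by apply: G_ge0 => //; exact: sub_ab.
Qed.

Lemma C0_le s tau : s \in `]0, 1[ -> tau \in `[0, 1] -> 0 <= C0 G ->
  C0 G * G tau s <= \int[mu]_(t in `[0, 1]) G t s.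
Proof.
move=> s01 tau01 C00; have s01' := subset_itv_oo_cc s01.
have S0 := green_sup_gt0 s01.
apply: (@le_trans _ _ (C0 G * green_sup G s)).
  by rewrite ler_wpM2l// green_le_sup.
rewrite mulrC -ler_pdivlMl//; apply: ge_inf; last by exists s.
exists 0 => _ [r r01 <-]; rewrite mulr_ge0 ?invr_ge0 ?(ltW (green_sup_gt0 r01))//.
by apply: Rintegral_ge0 => t t01; apply: G_ge0 => //; exact: subset_itv_oo_cc r01.
Qed.

(** The quadrature rule replaces the integral in t, both of G t s for every s
    and of green_op h t, by the same finite sum up to an error; for finite sums
    the exchange with the integral in s is linearity. *)
Lemma C0_green_op h tau : bmeas h -> {in `[0, 1], forall s, 0 <= h s} ->
  tau \in `[0, 1] -> 0 <= C0 G ->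
  C0 G * green_op h tau <= \int[mu]_(t in `[0, 1]) green_op h t.
Proof.
move=> hm h0 tau01 C00; have [_ [M hM]] := hm.
pose H := `|M|.
have hH : {in `[0, 1], forall s, `|h s| <= H}.
  by move=> s s01; apply: le_trans (hM s s01) (ler_norm _).
apply/ler_addgt0Pl => e e0.
have H1 : 0 < H + 1 by rewrite ltr_wpDl ?normr_ge0.
pose e1 := e / 2 / (H + 1).
have e10 : 0 < e1 by rewrite !divr_gt0.
have e2 : 0 < e / 2 by rewrite divr_gt0.
have [d1 d10 Hd1] := green_equi e10.
have [d2 d20 Hd2] := green_op_equi (normr_ge0 M) e2.
have d0 : 0 < Num.min d1 d2 by rewrite lt_min d10.
have [n [nd [W [nd01 W0 quad]]]] := quadrature d0.
have q1 : `|\sum_i green_op h (nd i) * W i - \int[mu]_(t in `[0, 1]) green_op h t| <= e / 2.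
  apply: quad; first exact: green_op_cont.
  by move=> x y x01 y01; rewrite lt_min => /andP[_ xy]; apply: (Hd2 h).
have q2 s : s \in `[0, 1] ->
    `|\sum_i G (nd i) s * W i - \int[mu]_(t in `[0, 1]) G t s| <= e1.
  move=> s01; apply: quad; first exact: green_cont_l.
  by move=> x y x01 y01; rewrite lt_min => /andP[xy _]; apply/ltW/Hd1.
have iF i : mu.-integrable `[0, 1] (EFin \o (fun s => (G (nd i) s * h s) * W i)).
  apply: integrable_bmeas; first exact: green_int.
  exact: cst_bmeas.
have [iS eS] := Rintegral_sum iF.
have sumE : \sum_i green_op h (nd i) * W i =
    \int[mu]_(s in `[0, 1]) (\sum_i (G (nd i) s * h s) * W i).
  by rewrite eS; apply: eq_bigr => i _; rewrite RintegralZr//; exact: green_int.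
have low : C0 G * green_op h tau - e / 2 <= \sum_i green_op h (nd i) * W i.
  rewrite sumE /green_op -RintegralZl//; last exact: green_int.
  have iC : mu.-integrable `[0, 1] (EFin \o (fun s => C0 G * (G tau s * h s))).
    apply: bmeas_integrable; apply: bmeasM; last apply: bmeasM => //.
      exact: cst_bmeas.
    exact/continuous_bmeas/green_cont_r.
  have -> : e / 2 = \int[mu]_(s in `[0, 1]) (e / 2) by rewrite Rintegral_cst_itv// subr0 mulr1.
  rewrite -RintegralB//; last exact: integrable_cst01.
  apply: le_Rintegral_oo => //; first by apply: integrable_sub_fun => //; exact: integrable_cst01.
  move=> s s01; have s01' := subset_itv_oo_cc s01.
  have hs0 := h0 s s01'; have := hH s s01'; rewrite ger0_norm// => hsH.
  have -> : \sum_i (G (nd i) s * h s) * W i = (\sum_i G (nd i) s * W i) * h s.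
    by rewrite mulr_suml; apply: eq_bigr => i _; rewrite mulrAC.
  have c0 := C0_le s01 tau01 C00.
  have := q2 s s01'; rewrite ler_norml => /andP[q2s _].
  have : (C0 G * G tau s - e1) * h s <= (\sum_i G (nd i) s * W i) * h s.
    by rewrite ler_wpM2r//; lra.
  apply: le_trans; rewrite mulrBl mulrA lerB//.
  rewrite /e1 mulrAC ler_pdivrMr// ler_wpM2l ?(ltW e2)//.
  by apply: le_trans hsH _; rewrite lerDl.
by move: q1; rewrite ler_norml => /andP[_ q1]; lra.
Qed.

(** Both cone conditions hold for each density concentrated at s, by the
    definitions of eta0 and C0, and are preserved by integration in s. *)
Lemma green_op_cone h (c : R) : bmeas h -> {in `[0, 1], forall s, 0 <= h s} ->
  0 <= C0 G -> 0 <= c -> cone G alpha beta eta0 (fun t => c * green_op h t).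
Proof.
move=> hm h0 C00 c0; pose u t := c * green_op h t.
have uc : {within `[0, 1], continuous u}.
  by move=> x; apply: cvgM; [exact: cvg_cst|exact: green_op_cont].
have u0 : {in `[0, 1], forall t, 0 <= u t}.
  by move=> t t01; rewrite mulr_ge0// green_op_ge0.
have iu : mu.-integrable `[0, 1] (EFin \o green_op h).
  exact/continuous_integrable/green_op_cont.
have ab0 : alpha \in `[alpha, beta] by rewrite in_itv/= lexx ltW.
split => //.
- apply: (@le_min_on _ _ _ _ _ alpha) => // t tab.
  rewrite -ler_pdivlMl//; apply: max_norm_le => tau tau01.
  rewrite ger0_norm ?u0// ler_pdivlMl// /u mulrCA ler_wpM2l//.
  rewrite /green_op -RintegralZl//; last exact: green_int.
  apply: le_Rintegral => //.
  + apply: bmeas_integrable; apply: bmeasM; last apply: bmeasM => //.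
      exact: cst_bmeas.
    exact/continuous_bmeas/green_cont_r.
  + exact/green_int/sub_ab.
  + by move=> s s01; rewrite mulrA ler_wpM2r ?h0// green_le_harnack.
- have -> : fconv (fun=> 1) u 1 = c * \int[mu]_(t in `[0, 1]) green_op h t.
    rewrite -RintegralZl//; apply: eq_Rintegral => t _; rewrite mul1r//.
  move: C00; rewrite le_eqVlt => /predU1P[<-|C00].
    rewrite mul0r mulr_ge0//; apply: Rintegral_ge0 => t t01; exact: green_op_ge0.
  rewrite -ler_pdivlMl//; apply: max_norm_le => tau tau01.
  rewrite ger0_norm ?u0// ler_pdivlMl// /u mulrCA ler_wpM2l//.
  by apply: C0_green_op => //; exact: ltW.
Qed.

Lemma le_greenM t : t \in `[0, 1] ->
  \int[mu]_(s in `[0, 1]) G t s <= greenM G.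
Proof.
move=> t01; have [M M0 HM] := green_bounded.
apply: (@le_max_on _ _ `[0, 1]%classic
  (fun tau => \int[mu]_(s in `[0, 1]) G tau s) M) => // tau tau01.
have itau := continuous_integrable (green_cont_r tau01).
apply: le_trans (ler_norm _) _; apply: norm_Rintegral_le => // s s01.
by rewrite ger0_norm ?G_ge0 ?HM.
Qed.

End GreenOperator.

(** * A priori bounds in the cone *)
Section ConeEstimates.
Variables (R : realType) (b p : R -> R) (G : R -> R -> R).
Variables (pm pp alpha beta eta0 : R).
Notation mu := (@lebesgue_measure R).
Hypothesis b_ge0 : {in `]0, 1], forall t, 0 <= b t}.
Hypothesis b_L1 : mu.-integrable `]0, 1] (EFin \o b).
Hypothesis b_neq0 : fconv b (fun=> 1) 1 != 0.
Hypothesis p_cont : {within `[0, 1], continuous p}.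
Hypothesis p_bnd : {in `[0, 1], forall t, pm <= p t <= pp}.
Hypothesis pm_gt0 : 0 < pm.
Hypothesis pp_gt0 : 0 < pp.
Hypothesis alpha_ge0 : 0 <= alpha.
Hypothesis alpha_beta : alpha < beta.
Hypothesis beta_le1 : beta <= 1.
Hypothesis eta0_gt0 : 0 < eta0.
Implicit Types u : R -> R.
Let mass := fconv b (fun=> 1) 1.

Lemma mass_gt0 : 0 < mass.
Proof. by rewrite lt_neqAle eq_sym b_neq0 mass_ge0. Qed.

Lemma cone_nncont u : cone G alpha beta eta0 u -> nncont u.
Proof. by case. Qed.

Lemma max_norm_ge0 u : nncont u -> 0 <= max_norm u.
Proof.
move=> [uc _]; apply: le_trans (le_max_norm uc (_ : 0 \in `[0, 1])) => //.
by rewrite in_itv/= lexx ler01.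
Qed.

Lemma nncont_le_norm u : nncont u -> {in `[0, 1], forall t, u t <= max_norm u}.
Proof. by move=> [uc _] t t01; apply: le_trans (ler_norm _) (le_max_norm uc t01). Qed.

Lemma cone_ge u : cone G alpha beta eta0 u ->
  {in `[alpha, beta], forall t, eta0 * max_norm u <= u t}.
Proof.
move=> [uc u0 um _] t tab; apply: le_trans um _.
apply: (@min_on_le _ _ `[alpha, beta]%classic u 0) => // y; rewrite /= in_itv/=.
move=> /andP[y1 y2]; apply: u0.
by rewrite in_itv/= (le_trans alpha_ge0 y1) (le_trans y2 beta_le1).
Qed.

Lemma mlow_ge0 rho : 0 <= mlow b pm pp rho.
Proof.
rewrite /mlow /eps; case: ifP => _; last by rewrite addr0 powR_ge0.
by rewrite addrC subrK powR_ge0.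
Qed.

Lemma mlow_le_norm u rho : nncont u -> 0 < rho -> rho <= nonlocal b p u ->
  mlow b pm pp rho <= max_norm u.
Proof.
move=> uN rho0 rhole; set N := max_norm u.
have N0 : 0 <= N by exact: max_norm_ge0.
have := nonlocal_le b_ge0 b_L1 pm_gt0 p_cont p_bnd uN (nncont_le_norm uN).
move=> /(le_trans rhole); rewrite -ler_pdivrMr ?mass_gt0// -/mass -/N.
rewrite /mlow /eps -/mass; set r := rho / mass => rN.
have r0 : 0 < r by rewrite divr_gt0// mass_gt0.
have root (x : R) : 0 < x -> r <= N `^ x -> r `^ x^-1 <= N.
  move=> x0 rNx; have -> : N = (N `^ x) `^ x^-1 by rewrite -powRrM divff ?gt_eqF// powRr1.
  by apply: ge0_ler_powR; rewrite ?nnegrE ?invr_ge0 ?powR_ge0// ltW.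
have le1 (x y : R) : 0 <= x <= 1 -> 0 < y -> x `^ y <= 1.
  move=> /andP[x0 x1] y0; have -> : (1 : R) = 1 `^ y by rewrite powR1.
  by apply: ge0_ler_powR; rewrite ?nnegrE// ltW.
have ge1 (x y : R) : 1 <= x -> 0 < y -> 1 <= x `^ y.
  move=> x1 y0; have {1}-> : (1 : R) = 1 `^ y by rewrite powR1.
  by apply: ge0_ler_powR; rewrite ?nnegrE ?(le_trans _ x1)// ltW.
have pmpp : pm <= pp.
  have /p_bnd/andP[] : (0 : R) \in `[0, 1] by rewrite in_itv/= lexx ler01.
  exact: le_trans.
have ippg : 0 < pp^-1 by rewrite invr_gt0.
have ipmg : 0 < pm^-1 by rewrite invr_gt0.
have [r1|r1] := ltP r 1.
  have rlt : r `^ pp^-1 < 1.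
    have -> : (1 : R) = 1 `^ pp^-1 by rewrite powR1.
    by apply: gt0_ltr_powR; rewrite ?nnegrE// ltW.
  rewrite powR_gt0// rlt/= addrC subrK.
  have [N1|N1] := leP 1 N.
    by apply: le_trans N1; apply: le1 => //; rewrite !ltW.
  move: rN; rewrite le_max => /orP[rpp|rpm]; last exact: root.
  apply: root => //; apply: (le_trans rpp); move: N0; rewrite le_eqVlt => /predU1P[<-|N0].
    by rewrite powR0 ?powR_ge0 ?gt_eqF.
  by apply: ger_powR pmpp; rewrite N0 ltW.
have r_ge1 : 1 <= r `^ pp^-1 by exact: ge1.
rewrite (ltNge _ 1) r_ge1 andbF addr0.
move: rN; rewrite le_max => /orP[rpp|rpm]; first exact: root.
apply: root => //; have [N1|N1] := leP 1 N; first by apply: le_trans rpm (ler_powR N1 pmpp).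
have : N `^ pm < 1.
  have -> : (1 : R) = 1 `^ pm by rewrite powR1.
  by apply: gt0_ltr_powR; rewrite ?nnegrE.
by move=> /(le_lt_trans (le_trans r1 rpm)); rewrite ltxx.
Qed.

(** A consequence of [nonlocal_cont]: the strict bound on the set becomes a
    large bound on its closure. *)
Lemma Vhat_closure_le u rho : nncont u ->
  Vhat_closure G alpha beta eta0 b p rho u -> nonlocal b p u <= rho.
Proof.
move=> uN [_ cl]; apply/ler_addgt0Pl => e e0.
have [d d0 Hd] := nonlocal_cont b_ge0 b_L1 pm_gt0 p_cont p_bnd uN e0.
have nb : nbhs (u : {uniform` `[0, 1] -> R})
    [set v | forall t, t \in `[0, 1] -> `|v t - u t| <= d].
  apply/uniform_nbhs; exists [set xy | ball xy.1 d xy.2]; split.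
    exact: (entourage_ball _ (PosNum d0)).
  move=> v /= Hv t t01; apply: ltW; rewrite distrC; exact: (Hv t t01).
have [v [[vcone vrho] vu]] := cl _ nb.
have := Hd v (cone_nncont vcone) vu; rewrite ler_norml => /andP[H _].
by move: (nonlocal b p v) (nonlocal b p u) H vrho => x y; lra.
Qed.

Lemma nontrivial_of_nonlocal u : nncont u -> 0 < nonlocal b p u ->
  exists2 t, t \in `[0, 1] & u t != 0.
Proof.
move=> uN; apply: contraPP => nex; apply/negP; rewrite -leNgt.
have u0 : {in `[0, 1], forall t, u t <= 0}.
  move=> t t01; have [->//|ut] := eqVneq (u t) 0.
  by exfalso; apply: nex; exists t.
apply: le_trans (nonlocal_le b_ge0 b_L1 pm_gt0 p_cont p_bnd uN u0) _.
by rewrite !powR0 ?gt_eqF// maxxx mul0r.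
Qed.

Section Mbar.
Variable q : R.
Hypothesis q_gt1 : 1 < q.
Hypothesis b_gt0 : {ae mu, forall t, t \in `]0, 1] -> 0 < b t}.
Hypothesis bq_L1 : mu.-integrable `]0, 1] (EFin \o (fun s => b s `^ (1 - q)^-1)).

Lemma Mbar_ge0 rho : 0 <= Mbar b alpha beta eta0 pm q rho.
Proof. by rewrite /Mbar !mulr_ge0 ?powR_ge0// invr_ge0 ltW. Qed.

Lemma le_Mbar rho rho' : 0 < rho -> rho <= rho' ->
  Mbar b alpha beta eta0 pm q rho <= Mbar b alpha beta eta0 pm q rho'.
Proof.
move=> rho0 le; have q0 : 0 < q by apply: lt_trans q_gt1.
have rho'0 : 0 < rho' by apply: lt_le_trans le.
rewrite /Mbar; apply: ler_wpM2l.
  by apply: mulr_ge0; [rewrite invr_ge0 ltW|exact: powR_ge0].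
have qpm0 : 0 <= q / pm by rewrite divr_ge0// ltW.
apply: ge0_ler_powR => //; rewrite ?nnegrE.
- by rewrite addr_ge0// mulr_ge0// powR_ge0.
- by rewrite addr_ge0// mulr_ge0// powR_ge0.
- rewrite lerD2r ler_wpM2r ?powR_ge0//.
  by apply: ge0_ler_powR; rewrite ?nnegrE ?invr_ge0// ltW.
Qed.

Lemma norm_le_Mbar u rho : cone G alpha beta eta0 u -> 0 < rho ->
  nonlocal b p u <= rho -> max_norm u <= Mbar b alpha beta eta0 pm q rho.
Proof.
move=> uC rho0 phile; have uN := cone_nncont uC.
have Y0 : 0 <= eta0 * max_norm u by rewrite mulr_ge0 ?max_norm_ge0// ltW.
have := le_dual_bound b_ge0 b_L1 pm_gt0 p_cont p_bnd q_gt1 b_gt0 bq_L1 uN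
  alpha_ge0 alpha_beta beta_le1 rho0 Y0 (cone_ge uC) phile.
by rewrite /Mbar -mulrA ler_pdivlMl.
Qed.

End Mbar.
End ConeEstimates.

(** * The truncated operator *)
Section Clip.
Variable R : realType.
Implicit Types x y l : R.

Lemma dist_max x y l : `|Num.max x l - Num.max y l| <= `|x - y|.
Proof.
have [xl|xl] := leP x l; have [yl|yl] := leP y l; rewrite ?subrr ?normr0// ler_norml;
  have := ler_norm (x - y); have := ler_norm (y - x); rewrite (distrC y); lra.
Qed.

Lemma dist_min x y l : `|Num.min x l - Num.min y l| <= `|x - y|.
Proof.
have [xl|xl] := leP x l; have [yl|yl] := leP y l; rewrite ?subrr ?normr0// ler_norml;
  have := ler_norm (x - y); have := ler_norm (y - x); rewrite (distrC y); lra.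
Qed.

End Clip.

Section Truncation.
Variables (R : realType) (lambda : R) (A : R -> R) (f G : R -> R -> R).
Variables (b p : R -> R) (rho1 rho2 pm pp alpha beta eta0 m M : R).
Notation mu := (@lebesgue_measure R).
Hypothesis lambda_gt0 : 0 < lambda.
Hypothesis A_cont : {within `[0, +oo[, continuous A}.
Hypothesis f_cont : {within `[0, 1] `*` `[0, +oo[, continuous (uncurry f)}.
Hypothesis f_ge0 : forall t x, t \in `[0, 1] -> 0 <= x -> 0 <= f t x.
Hypothesis b_ge0 : {in `]0, 1], forall t, 0 <= b t}.
Hypothesis b_L1 : mu.-integrable `]0, 1] (EFin \o b).
Hypothesis rho1_gt0 : 0 < rho1.
Hypothesis rho12 : rho1 < rho2.
Hypothesis A_gt0 : {in `[rho1, rho2], forall t, 0 < A t}.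
Hypothesis p_cont : {within `[0, 1], continuous p}.
Hypothesis p_bnd : {in `[0, 1], forall t, pm <= p t <= pp}.
Hypothesis pm_gt0 : 0 < pm.
Hypothesis G_cont : {within `[0, 1] `*` `[0, 1], continuous (uncurry G)}.
Hypothesis G_ge0 : forall t s, t \in `[0, 1] -> s \in `[0, 1] -> 0 <= G t s.
Hypothesis green_sup_gt0 : {in `]0, 1[, forall s, 0 < green_sup G s}.
Hypothesis alpha_ge0 : 0 <= alpha.
Hypothesis alpha_beta : alpha < beta.
Hypothesis beta_le1 : beta <= 1.
Hypothesis eta0_gt0 : 0 < eta0.
Hypothesis G_harnack : {in `[0, 1], forall s,
  min_on `[alpha, beta] (fun t => G t s) >= eta0 * green_sup G s}.
Hypothesis C0_gt0 : 0 < C0 G.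
Hypothesis m_ge0 : 0 <= m.
Hypothesis M_ge0 : 0 <= M.
Implicit Types u v : R -> R.

Definition clip (x : R) : R := Num.min (Num.max x rho1) rho2.

Definition coeff (x : R) : R := lambda * (A (clip x))^-1.

(** In the application m = eta0 * mlow rho1 and M = Mbar rho2.  The lower cut
    is restricted to [alpha, beta] because the cone gives no positive lower
    bound elsewhere. *)
Definition trunc u (s : R) : R :=
  Num.min (if s \in `[alpha, beta] then Num.max (u s) m else u s) M.

Definition trunc_op u (t : R) : R :=
  coeff (nonlocal b p u) * green_op G (fun s => f s (trunc u s)) t.

Lemma clip_itv x : clip x \in `[rho1, rho2].
Proof.
by rewrite in_itv/= /clip le_min ge_min lexx orbT andbT le_max lexx orbT ltW.
Qed.

Lemma dist_clip x y : `|clip x - clip y| <= `|x - y|.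
Proof. exact: le_trans (dist_min _ _ _) (dist_max _ _ _). Qed.

Lemma coeff_ge0 x : 0 <= coeff x.
Proof. by rewrite mulr_ge0 ?invr_ge0 ?ltW// A_gt0// clip_itv. Qed.

Let Ainv_cont : {within `[rho1, rho2], continuous (fun x => (A x)^-1)}.
Proof.
have /subspace_continuousP Ac : {within `[rho1, rho2], continuous A}.
  apply: continuous_subspaceW A_cont => x /=; rewrite !in_itv/= andbT.
  by move=> /andP[+ _]; apply: le_trans; exact: ltW.
apply/subspace_continuousP => x xr; apply: cvgV; last exact: Ac.
by rewrite gt_eqF// A_gt0.
Qed.

Lemma coeff_bounded : exists2 L, 0 <= L & forall x, coeff x <= L.
Proof.
have [L L0 HL] := compact_image_bounded (@segment_compact _ rho1 rho2) Ainv_cont.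
exists (lambda * L); first by rewrite mulr_ge0// ltW.
move=> x; rewrite ler_pM2l//; apply: le_trans (ler_norm _) _; apply: HL.
exact: clip_itv.
Qed.

Lemma coeff_cont x e : 0 < e -> exists2 d, 0 < d &
  forall y, `|y - x| < d -> `|coeff y - coeff x| <= e.
Proof.
move=> e0; have e'0 : 0 < e / lambda by rewrite divr_gt0.
have /subspace_continuousP/(_ (clip x) (clip_itv x))/cvgrPdist_le/(_ _ e'0) := Ainv_cont.
rewrite near_withinE => /nbhs_ballP[d /= d0 Hd]; exists d => // y yx.
rewrite -mulrBr normrM gtr0_norm// mulrC -ler_pdivlMr// distrC.
apply: (Hd (clip y)) (clip_itv y); rewrite /ball/= distrC.
exact: le_lt_trans (dist_clip _ _) yx.
Qed.

Lemma trunc_bounds u s : s \in `[0, 1] -> nncont u -> 0 <= trunc u s <= M.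
Proof.
move=> s01 [_ u0]; rewrite /trunc le_min M_ge0 andbT ge_min lexx orbT andbT.
by case: ifP => _; [rewrite le_max m_ge0 orbT|exact: u0].
Qed.

Lemma dist_trunc u v s : `|trunc u s - trunc v s| <= `|u s - v s|.
Proof.
rewrite /trunc; case: ifP => _; last exact: dist_min.
exact: le_trans (dist_min _ _ _) (dist_max _ _ _).
Qed.

Let rect_compact : compact (`[0, 1] `*` `[0, M] : set (R * R)).
Proof. by apply: compact_setX; exact: segment_compact. Qed.

Let f_cont_rect : {within `[0, 1] `*` `[0, M], continuous (uncurry f)}.
Proof.
apply: continuous_subspaceW f_cont => -[x y] /= [xab]; rewrite !in_itv/= andbT.
by move=> /andP[].
Qed.

Lemma f_trunc_bounded : exists2 F, 0 <= F & forall u, nncont u ->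
  {in `[0, 1], forall s, `|f s (trunc u s)| <= F}.
Proof.
have [F F0 HF] := compact_image_bounded rect_compact f_cont_rect.
exists F => // u uN s s01; apply: (HF (s, trunc u s)); split => //=.
by rewrite in_itv/= trunc_bounds.
Qed.

Lemma f_trunc_ge0 u : nncont u -> {in `[0, 1], forall s, 0 <= f s (trunc u s)}.
Proof. by move=> uN s s01; apply: f_ge0 => //; have /andP[] := trunc_bounds s01 uN. Qed.

(** The integrand may jump at alpha and beta; it is continuous on each piece. *)
Lemma f_trunc_bmeas u : nncont u -> bmeas (fun s => f s (trunc u s)).
Proof.
move=> uN; split; last first.
  by have [F _ HF] := f_trunc_bounded; exists F => s s01; exact: HF.
have [uc u0] := uN.
pose g1 s := f s (Num.min (Num.max (u s) m) M).
pose g2 s := f s (Num.min (u s) M).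
have minc (g : R -> R) : {within `[0, 1], continuous g} ->
    {within `[0, 1], continuous (fun s => Num.min (g s) M)}.
  move=> gc x; have := @continuous_min _ _ (g : subspace `[0, 1] -> R^o) (cst M) x.
  by apply; [exact: gc|exact: cvg_cst].
have maxc (g : R -> R) : {within `[0, 1], continuous g} ->
    {within `[0, 1], continuous (fun s => Num.max (g s) m)}.
  move=> gc x; have := @continuous_max _ _ (g : subspace `[0, 1] -> R^o) (cst m) x.
  by apply; [exact: gc|exact: cvg_cst].
have mg (g : R -> R) : {within `[0, 1], continuous g} -> {in `[0, 1], forall s, 0 <= g s} ->
    measurable_fun (`[0, 1]%classic : set (measurableTypeR R)) (fun s => f s (g s)).
  move=> gc g0.
  have fgc : {within `[0, 1], continuous (fun s => f s (g s))}.
    have := @within_continuous_pair R f _ id g f_cont (@within_continuous_id R) gc; apply => s s01.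
    by split => //=; rewrite in_itv/= andbT g0.
  by have [] := continuous_bmeas fgc.
have fE : (fun s => f s (trunc u s)) = (fun s => if s \in `[alpha, beta] then g1 s else g2 s).
  by apply/funext => s; rewrite /trunc /g1 /g2; case: ifP.
have mitv : measurable_fun (`[0, 1]%classic : set (measurableTypeR R))
    (fun s : R => s \in `[alpha, beta]).
  apply: (measurable_fun_bool true).
  rewrite (_ : _ @^-1` _ = `[alpha, beta]%classic); first exact: measurableI.
  by apply/seteqP; split => s.
refine (eq_ind_r (fun h : R -> R =>
  measurable_fun (`[0, 1]%classic : set (measurableTypeR R)) h) _ fE).
apply: measurable_fun_if => //.
- apply: measurable_funS (mg _ (minc _ (maxc _ uc)) _) => //.
  by move=> s s01; rewrite le_min le_max m_ge0 orbT.
- apply: measurable_funS (mg _ (minc _ uc) _) => //.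
  by move=> s s01; rewrite le_min u0.
Qed.

Lemma trunc_op_cone u : nncont u -> cone G alpha beta eta0 (trunc_op u).
Proof.
move=> uN; apply: green_op_cone => //.
- exact: f_trunc_bmeas.
- exact: f_trunc_ge0.
- exact: ltW.
- exact: coeff_ge0.
Qed.

(** The witness is the image of the fixed point on [0, 1] given by [schauder],
    so that the equation holds at every real t. *)
Lemma trunc_op_fixpoint : exists2 u, cone G alpha beta eta0 u &
  forall t, u t = trunc_op u t.
Proof.
have [L L0 HL] := coeff_bounded.
have [F F0 HF] := f_trunc_bounded.
have [Gb Gb0 HG] := green_bounded G_cont.
have hm u := @f_trunc_bmeas u.
have gop u t : nncont u -> t \in `[0, 1] -> `|green_op G (fun s => f s (trunc u s)) t| <= Gb * F.
  move=> uN t01; apply: norm_Rintegral_le; first by apply: green_int => //; exact: hm.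
  move=> s s01; rewrite normrM ler_pM ?HF//.
  by rewrite ger0_norm ?HG ?G_ge0.
have K0 : 0 < L * (Gb * F) + 1 by rewrite ltr_wpDl// !mulr_ge0.
have [|||u uN ufix] := @schauder R trunc_op (L * (Gb * F) + 1) K0.
- move=> u uN t t01; have [_ u0 _ _] := trunc_op_cone uN; rewrite u0//=.
  apply: (@le_trans _ _ (L * (Gb * F))); last by rewrite lerDl.
  apply: ler_pM (HL _) _; rewrite ?coeff_ge0//.
    by apply: green_op_ge0 => //; exact: f_trunc_ge0.
  exact: le_trans (ler_norm _) (gop u t uN t01).
- move=> e e0; have L1 : 0 < L + 1 by rewrite ltr_wpDl.
  have e'0 : 0 < e / (L + 1) by rewrite divr_gt0.
  have [d d0 Hd] := green_op_equi G_cont F0 e'0.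
  exists d => // u uN s t s01 t01 st.
  rewrite -mulrBr normrM ger0_norm ?coeff_ge0//.
  apply: (@le_trans _ _ ((L + 1) * (e / (L + 1)))); last by rewrite mulrC divfK// gt_eqF.
  apply: ler_pM => //; first exact: coeff_ge0.
    by apply: le_trans (HL _) _; rewrite lerDl.
  by apply: Hd => //; [exact: hm|exact: HF].
- move=> u uN e e0.
  have GF1 : 0 < Gb * F + 1 by rewrite ltr_wpDl// mulr_ge0.
  have L1 : 0 < L * Gb + 1 by rewrite ltr_wpDl// mulr_ge0.
  have e1 : 0 < e / 2 / (Gb * F + 1) by rewrite !divr_gt0.
  have e2 : 0 < e / 2 / (L * Gb + 1) by rewrite !divr_gt0.
  have [d1 d10 Hd1] := coeff_cont (nonlocal b p u) e1.
  have d12 : 0 < d1 / 2 by rewrite divr_gt0.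
  have [d2 d20 Hd2] := nonlocal_cont b_ge0 b_L1 pm_gt0 p_cont p_bnd uN d12.
  have [d3 d30 Hd3] := heine rect_compact f_cont_rect e2.
  exists (Num.min d2 (d3 / 2)); first by rewrite lt_min d20 divr_gt0.
  move=> v vN vu t t01; rewrite /trunc_op.
  pose cu := coeff (nonlocal b p u); pose cv := coeff (nonlocal b p v).
  have c1 : `|cv - cu| <= e / 2 / (Gb * F + 1).
    apply: Hd1; apply: (@le_lt_trans _ _ (d1 / 2)); last by rewrite ltr_pdivrMr// ltr_pMr// ltr1n.
    by apply: Hd2 => // s s01; apply: le_trans (vu s s01) _; rewrite ge_min lexx.
  pose gv := green_op G (fun s => f s (trunc v s)) t.
  pose gu := green_op G (fun s => f s (trunc u s)) t.
  have c2 : `|gv - gu| <= Gb * (e / 2 / (L * Gb + 1)).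
    apply: green_op_dist => //; try exact: hm.
    move=> s s01; rewrite -mulrBr normrM ler_pM//.
      by rewrite ger0_norm ?HG ?G_ge0.
    apply/ltW/Hd3; rewrite ?subrr ?normr0//.
    - by split => //=; rewrite in_itv/= trunc_bounds.
    - by split => //=; rewrite in_itv/= trunc_bounds.
    - apply: le_lt_trans (dist_trunc _ _ _) _.
      apply: (@le_lt_trans _ _ (d3 / 2)); last by rewrite ltr_pdivrMr// ltr_pMr// ltr1n.
      by apply: le_trans (vu s s01) _; rewrite ge_min lexx orbT.
  suff : `|cv * gv - cu * gu| <= e by [].
  have -> : cv * gv - cu * gu = (cv - cu) * gv + cu * (gv - gu) by ring.
  apply: le_trans (ler_normD _ _) _; rewrite [leRHS]splitr !normrM; apply: lerD.
    apply: (@le_trans _ _ (e / 2 / (Gb * F + 1) * (Gb * F + 1))).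
      by apply: ler_pM => //; apply: le_trans (gop v t vN t01) _; rewrite lerDl.
    by rewrite divfK// gt_eqF.
  apply: (@le_trans _ _ (L * (Gb * (e / 2 / (L * Gb + 1))))).
    by apply: ler_pM => //; rewrite -normrM (ger0_norm (coeff_ge0 _)); exact: HL.
  rewrite mulrA mulrCA -[leRHS]mulr1 ler_wpM2l ?(ltW (divr_gt0 e0 _))//.
  by rewrite ler_pdivrMr// mul1r lerDl.
exists (trunc_op u); first exact: trunc_op_cone.
have phiE : nonlocal b p (trunc_op u) = nonlocal b p u.
  by apply: eq_Rintegral => s s01; rewrite -ufix//; move: s01; rewrite inE.
have truncE s : s \in `[0, 1] -> trunc (trunc_op u) s = trunc u s.
  by move=> s01; rewrite /trunc ufix.
move=> t; suff -> : trunc_op (trunc_op u) t = coeff (nonlocal b p (trunc_op u)) *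
    green_op G (fun s => f s (trunc u s)) t by rewrite phiE.
congr (_ * _); apply: eq_Rintegral => s; rewrite inE /= => s01.
by rewrite truncE.
Qed.


(** Otherwise the coefficient is lambda / A rho2 and u is bounded by the
    quantity X of condition (2), whose powers bound the functional. *)
Lemma trunc_op_fixpoint_lt u : nncont u -> {in `[0, 1], forall t, u t = trunc_op u t} ->
  fconv b (fun=> 1) 1 != 0 ->
  (let X := lambda * rect_max f 0 1 0 M * greenM G / A rho2 in
   Num.max (X `^ pp) (X `^ pm) < rho2 / fconv b (fun=> 1) 1) ->
  nonlocal b p u < rho2.
Proof.
move=> uN ufix b_neq0; set F := rect_max f 0 1 0 M; move=> /= cond2.
rewrite ltNge; apply/negP => rho2N.
have clipE : clip (nonlocal b p u) = rho2 by rewrite /clip min_r// le_max rho2N.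
set h := fun s => f s (trunc u s).
have hm : bmeas h := f_trunc_bmeas uN.
have h_le : {in `[0, 1], forall s, h s <= F}.
  have [F0 _ HF] := compact_image_bounded rect_compact f_cont_rect.
  move=> s s01.
  apply: (@le_max_on _ _ (`[0, 1] `*` `[0, M]) (uncurry f) F0 (s, trunc u s)).
    by move=> z /HF; apply: le_trans (ler_norm _).
  by split => //=; rewrite in_itv/=; exact: trunc_bounds.
set X := _ / A rho2 in cond2.
have A2 : 0 < A rho2 by apply: A_gt0; rewrite in_itv/= lexx ltW.
have F_ge0 : 0 <= F.
  have z01 : (0 : R) \in `[0, 1] by rewrite in_itv/= lexx ler01.
  exact: le_trans (f_trunc_ge0 uN z01) (h_le _ z01).
have u_leX : {in `[0, 1], forall t, u t <= X}.
  move=> t t01; rewrite ufix// /trunc_op /coeff clipE -/h.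
  have -> : X = lambda * (A rho2)^-1 * (F * greenM G) by rewrite /X; ring.
  have c0 : 0 <= lambda * (A rho2)^-1 by rewrite ltW// divr_gt0.
  rewrite ler_wpM2l//.
  have ic := continuous_integrable (green_cont_r G_cont t01).
  apply: (@le_trans _ _ (F * \int[lebesgue_measure]_(s in `[0, 1]) G t s)).
    rewrite -RintegralZl// /green_op; apply: le_Rintegral => //.
    - exact: green_int.
    - apply: bmeas_integrable; apply: bmeasM.
        exact: cst_bmeas.
      exact/continuous_bmeas/green_cont_r.
    - move=> s s01; rewrite mulrC ler_wpM2r ?G_ge0//.
      exact: h_le.
  rewrite ler_wpM2l//; exact: le_greenM.
have := nonlocal_le b_ge0 b_L1 pm_gt0 p_cont p_bnd uN u_leX.
move=> /(le_trans rho2N); rewrite -ler_pdivrMr; last exact: mass_gt0.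
by move=> /le_lt_trans/(_ cond2); rewrite ltxx.
Qed.

(** Otherwise the coefficient is lambda / A rho1 and the density is at least
    the minimum of f over [alpha, beta] * [m, M1] there, so that the norm of u
    is at least the quantity X whose power occurs in condition (1); the cone
    inequality on [alpha, beta] then contradicts that condition. *)
Lemma trunc_op_fixpoint_gt u M1 : nncont u ->
  {in `[0, 1], forall t, u t = trunc_op u t} ->
  {in `[alpha, beta], forall t, eta0 * max_norm u <= u t} ->
  eta0 <= 1 -> M1 <= M ->
  (nonlocal b p u <= rho1 -> {in `[0, 1], forall t, u t <= M1}) ->
  eta0 `^ pp *
    ((lambda * rect_min f alpha beta m M1 / A rho1 *
      max_on `[0, 1] (fun tau => \int[mu]_(s in `[alpha, beta]) G tau s)) `^ pm - 1) *
    \int[mu]_(s in `[alpha, beta]) b (1 - s) > rho1 ->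
  rho1 < nonlocal b p u.
Proof.
move=> uN ufix u_ge eta0_le1 M1M u_leM1; set fm := rect_min f alpha beta m M1.
set g := fun tau => \int[mu]_(s in `[alpha, beta]) G tau s => cond1.
rewrite ltNge; apply/negP => Nrho1.
have clipE : clip (nonlocal b p u) = rho1 by rewrite /clip max_r// min_l// ltW.
have sub_ab (t : R) : t \in `[alpha, beta] -> t \in `[0, 1].
  rewrite !in_itv/= => /andP[H1 H2].
  by rewrite (le_trans alpha_ge0 H1) (le_trans H2 beta_le1).
set h := fun s => f s (trunc u s).
have hm : bmeas h := f_trunc_bmeas uN.
have h0 : {in `[0, 1], forall s, 0 <= h s} := f_trunc_ge0 uN.
have A1 : 0 < A rho1 by apply: A_gt0; rewrite in_itv/= lexx ltW.
have c0 : 0 <= lambda / A rho1 by rewrite ltW// divr_gt0.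
have iG tau : tau \in `[0, 1] -> mu.-integrable `[0, 1] (EFin \o G tau).
  by move=> tau01; exact: continuous_integrable (green_cont_r G_cont tau01).
have z01 : (0 : R) \in `[0, 1] by rewrite in_itv/= lexx ler01.
have g0 tau : tau \in `[0, 1] -> 0 <= g tau.
  by move=> tau01; apply: Rintegral_ge0 => s sab; apply: G_ge0 => //; exact: sub_ab.
have gmax_ge0 : 0 <= max_on `[0, 1] g.
  apply: (le_trans (g0 0 z01)).
  apply: (@le_max_on _ _ `[0, 1]%classic g (greenM G)) => // tau tau01.
  apply: (le_trans _ (le_greenM G_cont G_ge0 tau01)).
  apply: Rintegral_sub_le => //; first exact: iG.
  by move=> s s01; apply: G_ge0 => //; exact: subset_itv_oo_cc s01.
have X_le : 0 <= lambda * fm / A rho1 * max_on `[0, 1] g <= max_norm u.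
  have [mM1|M1m] := leP m M1; last first.
    (* The rectangle is empty and the infimum of the empty set is 0, so X = 0. *)
    have -> : fm = 0.
      rewrite /fm /rect_min /min_on (_ : [set _ | _ in _] = set0) ?inf0//.
      apply/seteqP; split => // y [[x1 x2]] [_ /=]; rewrite in_itv/=.
      by move=> /andP[H1 H2]; have := le_lt_trans (le_trans H1 H2) M1m; rewrite ltxx.
    by rewrite mulr0 !mul0r lexx max_norm_ge0.
  have f_nonneg z : (`[alpha, beta] `*` `[m, M1] : set (R * R)) z -> 0 <= uncurry f z.
    case: z => x y [] /= /sub_ab x01; rewrite in_itv/= => /andP[my _].
    by apply: f_ge0 => //; exact: le_trans my.
  have fm_ge0 : 0 <= fm.
    apply: (@le_min_on _ _ _ _ _ (alpha, m)) => //.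
    by split; rewrite /= in_itv/= lexx// ltW.
  have h_ge : {in `[alpha, beta], forall s, fm <= h s}.
    move=> s sab; have us := u_leM1 Nrho1 s (sub_ab s sab).
    have truncE : trunc u s = Num.max (u s) m.
      by rewrite /trunc sab min_l// ge_max (le_trans us M1M) (le_trans mM1 M1M).
    apply: (@min_on_le _ _ _ _ 0 (s, trunc u s)) => //.
    by split => //; rewrite truncE /= in_itv/= le_max lexx orbT ge_max us.
  have cf0 : 0 <= lambda * fm / A rho1 by rewrite mulrAC mulr_ge0.
  have c_g tau : tau \in `[0, 1] -> lambda * fm / A rho1 * g tau <= max_norm u.
    move=> tau01; apply: le_trans (nncont_le_norm uN tau01).
    rewrite ufix// /trunc_op /coeff clipE -/h.
    have -> : lambda * fm / A rho1 * g tau = lambda / A rho1 * (fm * g tau) by ring.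
    rewrite ler_wpM2l//; have iGh := green_int G_cont hm tau01.
    apply: (@le_trans _ _ (\int[mu]_(s in `[alpha, beta]) (G tau s * h s))); last first.
      apply: Rintegral_sub_le => // s s01; have s01' := subset_itv_oo_cc s01.
      by rewrite mulr_ge0 ?h0// G_ge0.
    rewrite /g -RintegralZl//; last by apply: integrable_sub01 => //; exact: iG.
    apply: le_Rintegral => //.
    - apply: integrable_sub01 => //; apply: bmeas_integrable; apply: bmeasM.
        exact: cst_bmeas.
      exact/continuous_bmeas/green_cont_r.
    - exact: integrable_sub01.
    - move=> s sab; rewrite mulrC ler_wpM2l ?h_ge// G_ge0//.
      exact: sub_ab.
  rewrite mulr_ge0//=; move: cf0; rewrite le_eqVlt => /predU1P[<-|cf0].
    by rewrite mul0r max_norm_ge0.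
  rewrite -ler_pdivlMl//; apply: (@max_on_le _ _ _ _ _ 0) => // tau tau01.
  by rewrite ler_pdivlMl// c_g.
have eta01 : 0 < eta0 <= 1 by rewrite eta0_gt0.
have := nonlocal_ge b_ge0 b_L1 pm_gt0 p_cont p_bnd uN alpha_ge0 beta_le1 eta01 X_le u_ge.
by move=> /(lt_le_trans cond1)/lt_le_trans/(_ Nrho1); rewrite ltxx.
Qed.

End Truncation.

Theorem theorem4p4 (R : realType) (lambda : R) (A : R -> R)
    (f G : R -> R -> R) (b p : R -> R) (rho1 rho2 pm pp q : R)
    (bc : set (R -> R)) (alpha beta eta0 : R)
    (lambda_gt0 : 0 < lambda)
    (A_cont : {within `[0, +oo[, continuous A})
    (f_cont : {within `[0, 1] `*` `[0, +oo[, continuous (uncurry f)})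
    (f_ge0 : forall t x, t \in `[0, 1] -> 0 <= x -> 0 <= f t x)
    (b_ge0 : {in `]0, 1], forall t, 0 <= b t})
    (b_L1 : (@lebesgue_measure R).-integrable `]0, 1] (EFin \o b))
    (b_gt0 : {ae @lebesgue_measure R, forall t, t \in `]0, 1] -> 0 < b t})
    (b_neq0 : fconv b (fun=> 1) 1 != 0)
    (rho1_gt0 : 0 < rho1)
    (rho12 : rho1 < rho2)
    (A_gt0 : {in `[rho1, rho2], forall t, 0 < A t})
    (p_cont : {within `[0, 1], continuous p})
    (p_gt0 : {in `[0, 1], forall t, 0 < p t})
    (p_bnd : {in `[0, 1], forall t, pm <= p t <= pp})
    (pm_gt0 : 0 < pm) (pm_lt1 : pm < 1) (pp_gt1 : 1 < pp)
    (bc_hom : homogeneous_bc bc)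
    (G_green : green_function bc G)
    (G_cont : {within `[0, 1] `*` `[0, 1], continuous (uncurry G)})
    (G_ge0 : forall t s, t \in `[0, 1] -> s \in `[0, 1] -> 0 <= G t s)
    (green_sup_gt0 : {in `]0, 1[, forall s, 0 < green_sup G s})
    (alpha_ge0 : 0 <= alpha) (alpha_beta : alpha < beta) (beta_le1 : beta <= 1)
    (eta0_gt0 : 0 < eta0) (eta0_le1 : eta0 <= 1)
    (G_harnack : {in `[0, 1], forall s,
      min_on `[alpha, beta] (fun t => G t s) >= eta0 * green_sup G s})
    (C0_gt0 : 0 < C0 G)
    (q_gt1 : 1 < q)
    (bq_L1 : (@lebesgue_measure R).-integrable `]0, 1]
       (EFin \o (fun s => b s `^ (1 - q)^-1)))
    (cond1 :
      eta0 `^ pp *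
      ((lambda * rect_min f alpha beta (eta0 * mlow b pm pp rho1)
                   (Mbar b alpha beta eta0 pm q rho1) / A rho1 *
        max_on `[0, 1] (fun tau =>
          \int[lebesgue_measure]_(s in `[alpha, beta]) G tau s)) `^ pm - 1) *
      \int[lebesgue_measure]_(s in `[alpha, beta]) b (1 - s) > rho1)
    (cond2 :
      let X := lambda *
               rect_max f 0 1 0 (Mbar b alpha beta eta0 pm q rho2) *
               greenM G / A rho2 in
      Num.max (X `^ pp) (X `^ pm) < rho2 / fconv b (fun=> 1) 1) :
  exists u0 : R -> R,
    [/\ positive_solution lambda A f G b p alpha beta eta0 u0,
        (Vhat G alpha beta eta0 b p rho2 `\`
           Vhat_closure G alpha beta eta0 b p rho1) u0 &
        (rho1 / fconv b (fun=> 1) 1) `^ pp^-1 + eps b pm pp rho1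
          <= max_norm u0
          <= eta0^-1 * (beta - alpha) `^ (- (q / pm)) *
             (rho2 `^ q^-1 *
                fconv (fun s => b s `^ (1 - q)^-1) (fun=> 1) 1
                  `^ ((q - 1) / q)
              + 1) `^ (q / pm)].

Proof.
have pp_gt0 : 0 < pp by apply: lt_trans pp_gt1.
have rho2_gt0 : 0 < rho2 by apply: lt_trans rho12.
have m_ge0 : 0 <= eta0 * mlow b pm pp rho1 by rewrite mulr_ge0 ?mlow_ge0// ltW.
have M_ge0 : 0 <= Mbar b alpha beta eta0 pm q rho2 by exact: Mbar_ge0.
have M1M : Mbar b alpha beta eta0 pm q rho1 <= Mbar b alpha beta eta0 pm q rho2.
  by apply: le_Mbar => //; exact: ltW.
have [u uC ufix] := trunc_op_fixpoint lambda_gt0 A_cont f_cont f_ge0 b_ge0 b_L1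
  rho1_gt0 rho12 A_gt0 p_cont p_bnd pm_gt0 G_cont G_ge0 green_sup_gt0
  alpha_ge0 alpha_beta beta_le1 eta0_gt0 G_harnack C0_gt0 m_ge0 M_ge0.
have uN := cone_nncont uC.
have u_le := nncont_le_norm uN.
have u_ge := cone_ge alpha_ge0 beta_le1 uC.
have norm_le rho : 0 < rho -> nonlocal b p u <= rho ->
    max_norm u <= Mbar b alpha beta eta0 pm q rho.
  exact: (norm_le_Mbar b_ge0 b_L1 p_cont p_bnd pm_gt0 alpha_ge0 alpha_beta
    beta_le1 eta0_gt0 q_gt1 b_gt0 bq_L1 uC).
have N_lt : nonlocal b p u < rho2.
  exact: (trunc_op_fixpoint_lt lambda_gt0 f_cont f_ge0 b_ge0 b_L1 rho12 A_gt0
    p_cont p_bnd pm_gt0 G_cont G_ge0 m_ge0 M_ge0 uN (fun t _ => ufix t) b_neq0 cond2).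
have N_gt : rho1 < nonlocal b p u.
  apply: (trunc_op_fixpoint_gt lambda_gt0 f_cont f_ge0 b_ge0 b_L1 rho12 A_gt0
    p_cont p_bnd pm_gt0 G_cont G_ge0 alpha_ge0 alpha_beta beta_le1 eta0_gt0
    m_ge0 M_ge0 uN (fun t _ => ufix t) u_ge eta0_le1 M1M _ cond1).
  by move=> Nrho1 t t01; apply: le_trans (u_le t t01) (norm_le _ _ Nrho1).
have clipE : clip rho1 rho2 (nonlocal b p u) = nonlocal b p u.
  by rewrite /clip max_l ?ltW// min_l// ltW.
have nuM := norm_le _ rho2_gt0 (ltW N_lt).
have nu_ge := mlow_le_norm b_ge0 b_L1 b_neq0 p_cont p_bnd pm_gt0 pp_gt0 uN
  rho1_gt0 (ltW N_gt).
have truncE : {in `[0, 1], forall s, trunc alpha beta (eta0 * mlow b pm pp rho1)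
    (Mbar b alpha beta eta0 pm q rho2) u s = u s}.
  move=> s s01; have usM := le_trans (u_le s s01) nuM.
  rewrite /trunc; case: ifP => sab; last by rewrite min_l.
  rewrite max_l ?min_l//; apply: le_trans (u_ge s sab).
  by rewrite ler_pM2l.
have AN : 0 < A (nonlocal b p u) by apply: A_gt0; rewrite in_itv/= !ltW.
exists u; split.
- split => //.
  + apply: (nontrivial_of_nonlocal b_ge0 b_L1 p_cont p_bnd pm_gt0 pp_gt0 uN).
    exact: lt_trans N_gt.
  + move=> t t01; rewrite ufix /trunc_op /coeff clipE /hammerstein -mulrA.
    congr (_ * _); rewrite /green_op -RintegralZl//; last first.
      by apply: green_int => //; exact: f_trunc_bmeas.
    apply: eq_Rintegral => s; rewrite inE/= => s01.
    by rewrite -mulrA truncE.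
- split; first by split.
  move=> /(Vhat_closure_le b_ge0 b_L1 p_cont p_bnd pm_gt0 uN).
  by rewrite leNgt N_gt.
- by apply/andP; split; [exact: nu_ge|exact: nuM].
Qed.
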